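(* Let $X_1\subseteq\mathbb{R}$ be finite (and nonempty), let $Sh(X_1)$ be its shift refinement, and let $P_{X_1}$ and $P_{Sh(X_1)}$ be the corresponding totally ordered sets. Let $j=j(X_1,Sh(X_1))$, and let $\mathcal{C}$ be the full subcategory of $A(P_{Sh(X_1)})$-mod given by $\mathcal{C}=\mathrm{im}(j)$. Let $D^{X_1}$ be the interleaving metric on $A(P_{X_1})$-mod, and let $D^{Sh(X_1)}$ and $D_B^{Sh(X_1)}$ be the interleaving metric and the bottleneck metric on $A(P_{Sh(X_1)})$-mod, restricted to $\mathcal{C}$. Then: 1. the identity $(\mathcal{C},D^{Sh(X_1)})\xrightarrow{\ \mathrm{Id}\ }(\mathcal{C},D_B^{Sh(X_1)})$ is an isometry, i.e. $D^{Sh(X_1)}(I,M)=D_B^{Sh(X_1)}(I,M)$ for all $I,M\in\mathcal{C}$; 2. $j:(A(P_{X_1})\text{-mod},D^{X_1})\to(\mathcal{C},D^{Sh(X_1)})$ is a contraction, i.e. $D^{Sh(X_1)}(jI,jM)\le D^{X_1}(I,M)$ for all $A(P_{X_1})$-modules $I,M$; 3. $j:(A(P_{X_1})\text{-mod},D^{X_1})\to(\mathcal{C},D_B^{Sh(X_1)})$ is a contraction, i.e. $D_B^{Sh(X_1)}(jI,jM)\le D^{X_1}(I,M)$ for all $A(P_{X_1})$-modules $I,M$.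
   Context: Fix a field $K$ and a real number $b>0$. **Posets and modules.** For a finite nonempty $X=\{x_1<\dots<x_n\}\subset\mathbb{R}$, $P_X$ is $X$ as a totally ordered set, and $P_X^+=P_X\cup\{\infty\}$ with $p\le\infty$ for all $p$. On $P_X^+$ use the weighted graph metric $d$ of the Hasse quiver with edge weights $x_{i+1}-x_i$ and weight $b$ on the edge from $x_n$ to $\infty$: $d(x_i,x_j)=|x_i-x_j|$ and $d(x_i,\infty)=x_n-x_i+b$. An $A(P_X)$-module is a functor $M$ from $P_X$ (as a thin category) to finite-dimensional $K$-vector spaces; morphisms are natural transformations. Each such $M$ is also regarded as a functor on $P_X^+$ with $M(\infty)=0$. The same $b$ is used for $X_1$ and $Sh(X_1)$ (note $\max Sh(X_1)=\max X_1$). **Translations and interleaving metric.** $\mathcal{T}(P_X)$ is the set of order-preserving maps $\Lambda:P_X^+\to P_X^+$ with $\Lambda p\ge p$ for all $p$; its height is $h(\Lambda)=\max_{p\in P_X^+}d(p,\Lambda p)$. For a module $M$, $M\Lambda$ is the module $(M\Lambda)(p)=M(\Lambda p)$, $(M\Lambda)(p\le q)=M(\Lambda p\le\Lambda q)$; similarly for a morphism $\alpha$, $(\alpha\Lambda)(p)=\alpha(\Lambda p)$. A $(\Gamma,\Lambda)$-interleaving between $F$ and $G$ is a pair of morphisms $\phi:F\to G\Lambda$, $\psi:G\to F\Gamma$ such that $(\psi\Lambda)\circ\phi:F\to F\Gamma\Lambda$ is the map with components $F(p\le\Gamma\Lambda p)$ and $(\phi\Gamma)\circ\psi:G\to G\Lambda\Gamma$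 is the map with components $G(p\le\Lambda\Gamma p)$. Set $$D^X(F,G)=\inf\{\epsilon:\ \exists\ (\Gamma,\Lambda)\text{-interleaving between }F,G\text{ with }h(\Gamma),h(\Lambda)\le\epsilon\}.$$ **Bottleneck metric.** Every indecomposable $A(P_X)$-module $I$ is, up to isomorphism, an interval module: $I\sim[x,y]$ with $x\le y$ in $X$, meaning $I$ is $K$ on $[x,y]$ with identity maps, and $0$ elsewhere. Its width is $$W(I)=\min\{\epsilon:\ \exists\Lambda,\Gamma\in\mathcal{T}(P_X),\ h(\Lambda),h(\Gamma)\le\epsilon,\ \mathrm{Hom}(I,I\Lambda\Gamma)=0\}.$$ The barcode $B(M)$ is the multiset of isomorphism classes of indecomposable summands of $M$. A matching between finite multisets $S,T$ of isomorphism classes of indecomposables is a bijection $f:S'\to T'$ with $S'\subseteq S$, $T'\subseteq T$ sub-multisets. For $\epsilon>0$ it is an $\epsilon$-matching if every $s\in S$ with $W(s)>\epsilon$ lies in $S'$, every $t\in T$ with $W(t)>\epsilon$ lies in $T'$, and $D^X(s,f(s))\le\epsilon$ for all $s\in S'$. Then $D_B^X(M,N)=\inf\{\epsilon:\text{there is an }\epsilon\text{-matching between }B(M)\text{ and }B(N)\}$. **The functor $j$.** For finite $X\subseteq Y\subset\mathbb{R}$ and $y\in Y$, let $x_y$ be the maximal element of $X$ with $x_y\le y$, if it exists. For an $A(P_X)$-module $I$, $j(X,Y)I$ is the $A(P_Y)$-module with $j(X,Y)I(y)=I(x_y)$ (and $0$ if $x_y$ does not exist) and $j(X,Y)I(y_1\le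 y_2)=I(x_{y_1}\le x_{y_2})$ (and $0$ if $x_{y_1}$ or $x_{y_2}$ does not exist). For a morphism $\alpha$, $j(X,Y)\alpha(y)=\alpha(x_y)$ (and $0$ if $x_y$ does not exist). The image $\mathrm{im}(j)$ is taken up to isomorphism. **Shift refinement.** Let $N_1$ be the set of all distances between points of $X$, and $Y=X\cup\{x-\epsilon:x\in X,\epsilon\in N_1\}=\{y_1>y_2>\dots>y_m\}$. Put $Z_0=Y$ and, for $i=0,\dots,m-1$, $Z_{i+1}=Z_i\cup\{z_{y_{i+1}}-\epsilon:\epsilon\in N_1\}$, where $z_{y_{i+1}}$ is the maximal element of $Z_i$ strictly less than $y_{i+1}$ (if there is none, $Z_{i+1}=Z_i$). Then $Sh(X)=Z_m$. *)

(* Defs.v *)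
From HB Require Import structures.
From mathcomp Require Import all_boot all_order all_algebra finmap.
From mathcomp Require Import boolp classical_sets reals.

Set Implicit Arguments.
Unset Strict Implicit.
Unset Printing Implicit Defensive.

Import Order.TTheory GRing.Theory Num.Theory.

Local Open Scope ring_scope.

(* Functors from a preordered set, seen as a thin category, to
   finite-dimensional K-vector spaces. *)

Record pfun (K : fieldType) (T : Type) (r : rel T) := PFun {
  ob :> T -> vectType K;
  mp : forall p q : T, r p q -> 'Hom(ob p, ob q);
  mp_id : forall (p : T) (h : r p p), mp h = \1%VF;
  mp_comp : forall (p q s : T) (hpq : r p q) (hqs : r q s) (hps : r p s),
    mp hps = (mp hqs \o mp hpq)%VF }.

Record mor (K : fieldType) (T : Type) (r : rel T) (M N : pfun K r) := Mor {
  cmp :> forall p : T, 'Hom(M p, N p);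
  cmp_nat : forall (p q : T) (h : r p q),
    (mp N h \o cmp p)%VF = (cmp q \o mp M h)%VF }.

Section Functors.
Variables (K : fieldType) (T : Type) (r : rel T).
Implicit Types M N : pfun K r.

Definition iso M N : Prop :=
  exists (f : mor M N) (g : mor N M),
    (forall p, (g p \o f p)%VF = \1%VF) /\ (forall p, (f p \o g p)%VF = \1%VF).

Definition hom_zero M N : Prop := forall (f : mor M N) (p : T), f p = 0.

Lemma homrV0 (U : vectType K) (f g : 'Hom(U, 'rV[K]_0)) : f = g.
Proof. by apply/lfunP => u; rewrite [f u]thinmx0 [g u]thinmx0. Qed.

Lemma homrV0l (U : vectType K) (f g : 'Hom('rV[K]_0, U)) : f = g.
Proof. by apply/lfunP => u; rewrite [u]thinmx0 !linear0. Qed.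

Definition zero_pfun : pfun K r :=
  @PFun K T r (fun=> 'rV[K]_0 : vectType K) (fun _ _ _ => 0)
    (fun _ _ => homrV0 _ _) (fun _ _ _ _ _ _ => homrV0 _ _).

Definition is_zero M : Prop := iso M zero_pfun.

Section Sum.
Variables M N : pfun K r.

Definition sum_ob (p : T) : vectType K := (M p * N p)%type.

Definition sum_fun p q (h : r p q) (u : sum_ob p) : sum_ob q :=
  (mp M h u.1, mp N h u.2).

Lemma sum_fun_linear p q (h : r p q) : linear (@sum_fun p q h).
Proof. by move=> a u v; rewrite /sum_fun /= !linearP. Qed.

HB.instance Definition _ p q (h : r p q) :=
  GRing.isLinear.Build K (sum_ob p) (sum_ob q) _ (@sum_fun p q h)
    (@sum_fun_linear p q h).

Definition sum_mp p q (h : r p q) : 'Hom(sum_ob p, sum_ob q) :=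
  linfun (@sum_fun p q h).

Lemma sum_mp_id p (h : r p p) : sum_mp h = \1%VF.
Proof.
apply/lfunP => u; rewrite lfunE id_lfunE /= /sum_fun !mp_id !id_lfunE.
by case: u.
Qed.

Lemma sum_mp_comp p q s (hpq : r p q) (hqs : r q s) (hps : r p s) :
  sum_mp hps = (sum_mp hqs \o sum_mp hpq)%VF.
Proof.
apply/lfunP => u; rewrite comp_lfunE !lfunE /= /sum_fun /=.
by rewrite !(mp_comp _ hpq hqs hps) !comp_lfunE.
Qed.

Definition sum_pfun : pfun K r := PFun sum_mp_id sum_mp_comp.
End Sum.

Fixpoint dsum (n : nat) : ('I_n -> pfun K r) -> pfun K r :=
  match n with
  | 0 => fun=> zero_pfun
  | n'.+1 => fun S => sum_pfun (S ord0) (dsum (fun i => S (lift ord0 i)))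
  end.

Definition indecomposable M : Prop :=
  ~ is_zero M /\
  forall A B : pfun K r, iso M (sum_pfun A B) -> is_zero A \/ is_zero B.

(* The family S lists representatives, with multiplicity, of the isomorphism
   classes of the indecomposable summands of M; it is determined by M up to
   isomorphism of its members and reordering (Krull-Schmidt). *)
Definition is_barcode M (n : nat) (S : 'I_n -> pfun K r) : Prop :=
  (forall i, indecomposable (S i)) /\ iso M (dsum S).

(* Extension by 0 at an additional point None. *)
Definition opt_ob M (p : option T) : vectType K :=
  if p is Some x then M x else 'rV[K]_0.

Definition top_rel : rel (option T) := fun p q =>
  match p, q with
  | Some x, Some y => r x y
  | _, None => true
  | None, Some _ => false
  end.

Definition bot_rel : rel (option T) := fun p q =>
  match p, q with
  | Some x, Some y => r x y
  | None, _ => true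
  | Some _, None => false
  end.

Definition top_mp M (p q : option T) :
    top_rel p q -> 'Hom(opt_ob M p, opt_ob M q) :=
  match p, q with
  | Some x, Some y => fun h => @mp K T r M x y h
  | _, _ => fun=> 0
  end.

Definition bot_mp M (p q : option T) :
    bot_rel p q -> 'Hom(opt_ob M p, opt_ob M q) :=
  match p, q with
  | Some x, Some y => fun h => @mp K T r M x y h
  | _, _ => fun=> 0
  end.

Lemma top_mp_id M p (h : top_rel p p) : top_mp M h = \1%VF.
Proof. by case: p h => [x|] h /=; [exact: mp_id|exact: homrV0]. Qed.

Lemma bot_mp_id M p (h : bot_rel p p) : bot_mp M h = \1%VF.
Proof. by case: p h => [x|] h /=; [exact: mp_id|exact: homrV0]. Qed.

Lemma top_mp_comp M p q s (hpq : top_rel p q) (hqs : top_rel q s)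
    (hps : top_rel p s) : top_mp M hps = (top_mp M hqs \o top_mp M hpq)%VF.
Proof.
case: p q s hpq hqs hps => [x|] [y|] [z|] //= *;
  by [exact: mp_comp|exact: homrV0|exact: homrV0l].
Qed.

Lemma bot_mp_comp M p q s (hpq : bot_rel p q) (hqs : bot_rel q s)
    (hps : bot_rel p s) : bot_mp M hps = (bot_mp M hqs \o bot_mp M hpq)%VF.
Proof.
case: p q s hpq hqs hps => [x|] [y|] [z|] //= *;
  by [exact: mp_comp|exact: homrV0|exact: homrV0l].
Qed.

Definition top_ext M : pfun K top_rel := PFun (@top_mp_id M) (@top_mp_comp M).
Definition bot_ext M : pfun K bot_rel := PFun (@bot_mp_id M) (@bot_mp_comp M).

End Functors.

Definition pullback (K : fieldType) (S T : Type) (rS : rel S) (rT : rel T)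
    (f : S -> T) (fh : forall p q, rS p q -> rT (f p) (f q))
    (M : pfun K rT) : pfun K rS :=
  @PFun K S rS (fun p => M (f p)) (fun p q h => mp M (fh p q h))
    (fun p h => mp_id M (fh p p h))
    (fun p q s hpq hqs hps =>
       mp_comp M (fh p q hpq) (fh q s hqs) (fh p s hps)).

Definition leX (R : realType) (X : {fset R}) : rel X :=
  fun p q => fsval p <= fsval q.
Arguments leX {R} X.

Notation pmod K X := (pfun K (leX X)).

(* P_X^+ is option X, with None the point at infinity. *)
Definition leXp (R : realType) (X : {fset R}) : rel (option X) :=
  top_rel (leX X).
Arguments leXp {R} X.

Record translation (R : realType) (X : {fset R}) := Translation {
  tr :> option X -> option X;
  tr_homo : forall p q, leXp X p q -> leXp X (tr p) (tr q);
  tr_ge : forall p, leXp X p (tr p) }.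

Section Metrics.
Variables (R : realType) (K : fieldType) (b : R) (X : {fset R}).
Implicit Types (p q : option X) (L G : translation X) (M N : pmod K X).

(* The first argument of the maximum being an element of X, this is the largest
   element of X. *)
Definition maxX (x : X) : R := \big[Num.max/fsval x]_(y : X) fsval y.

Definition dist p q : R :=
  match p, q with
  | Some x, Some y => `|fsval x - fsval y|
  | Some x, None | None, Some x => maxX x - fsval x + b
  | None, None => 0
  end.

Definition height L : R := \big[Num.max/0]_(p : option X) dist p (L p).

Lemma leXp_trans : transitive (leXp X).
Proof. by move=> [y|] [x|] [z|] //=; rewrite /leX; exact: le_trans. Qed.

Lemma tr_ge2 G L p : leXp X p (G (L p)).
Proof. exact: leXp_trans (tr_ge L p) (tr_ge G (L p)). Qed.

(* Modules, translated modules and their morphisms are considered on P_X^+,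
   where they vanish at infinity. *)
Definition shift (M : pfun K (leXp X)) L : pfun K (leXp X) :=
  pullback (@tr_homo R X L) M.

Definition interleaving G L M N
    (phi : mor (top_ext M) (shift (top_ext N) L))
    (psi : mor (top_ext N) (shift (top_ext M) G)) : Prop :=
  (forall p, (psi (L p) \o phi p)%VF = mp (top_ext M) (tr_ge2 G L p)) /\
  (forall p, (phi (G p) \o psi p)%VF = mp (top_ext N) (tr_ge2 L G p)).

Definition interleaved G L M N : Prop :=
  exists phi psi, @interleaving G L M N phi psi.

Definition dI M N : R :=
  inf [set e : R | exists G L : translation X,
    [/\ height G <= e, height L <= e & interleaved G L M N]]%classic.

(* The infimum is a minimum, as there are finitely many translations. *)
Definition width M : R :=
  inf [set e : R | exists L G : translation X,
    [/\ height L <= e, height G <= e &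
        hom_zero (top_ext M) (shift (shift (top_ext M) L) G)]]%classic.

(* A bijection between sub-multisets is a partial injection f between the sets
   of indices. *)
Definition is_matching (m n : nat) (f : 'I_m -> option 'I_n) : Prop :=
  forall i i' j, f i = Some j -> f i' = Some j -> i = i'.

Definition is_eps_matching (e : R) (m n : nat) (S : 'I_m -> pmod K X)
    (T : 'I_n -> pmod K X) (f : 'I_m -> option 'I_n) : Prop :=
  [/\ is_matching f,
      forall i, e < width (S i) -> exists j, f i = Some j,
      forall j, e < width (T j) -> exists i, f i = Some j &
      forall i j, f i = Some j -> dI (S i) (T j) <= e].

Definition dB M N : R :=
  inf [set e : R | 0 < e /\
    exists (m n : nat) (S : 'I_m -> pmod K X) (T : 'I_n -> pmod K X),
      [/\ is_barcode M S, is_barcode N T &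
          exists f, is_eps_matching e S T f]]%classic.

End Metrics.

Section Refinement.
Variable R : realType.
Implicit Types X Y Z N : {fset R}.

Definition floorX X (y : R) : option X :=
  [pick x : X | (fsval x <= y) &&
     [forall x' : X, (fsval x' <= y) ==> (fsval x' <= fsval x)]].

Lemma floorXP X (y : R) :
  match floorX X y with
  | Some x => fsval x <= y /\ forall x' : X, fsval x' <= y -> fsval x' <= fsval x
  | None => forall x' : X, ~~ (fsval x' <= y)
  end.
Proof.
rewrite /floorX; case: pickP => [x /andP[xy /forallP mx]|nox x'].
  by split=> // x' x'y; exact: (implyP (mx x')).
apply/negP => x'y.
have [x xy mx] := @Order.TotalTheory.arg_maxP _ R X x'
  (fun x : X => fsval x <= y) (fun x : X => fsval x) x'y.
move: (nox x); rewrite xy /= => /negbT/negP; apply.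
by apply/forallP => z; apply/implyP; exact: mx.
Qed.

Lemma floorX_homo X Y (p q : Y) : leX Y p q ->
  bot_rel (leX X) (floorX X (fsval p)) (floorX X (fsval q)).
Proof.
rewrite /leX => pq.
move: (floorXP X (fsval p)) (floorXP X (fsval q)).
case: (floorX X (fsval p)) => [x|]; case: (floorX X (fsval q)) => [x'|] //=.
  by move=> [xp _] [_]; apply; exact: le_trans pq.
by move=> [xp _] /(_ x); rewrite (le_trans xp pq).
Qed.

Definition jmod (K : fieldType) X Y (I : pmod K X) : pmod K Y :=
  pullback (@floorX_homo X Y) (bot_ext I).

Definition im_j (K : fieldType) X Y (M : pmod K Y) : Prop :=
  exists I : pmod K X, iso M (jmod Y I).

Definition distances X : {fset R} :=
  [fset (`|(x : R) - y| : R)%R | x in X, y in X]%fset.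

Definition refine_step N Z (y : R) : {fset R} :=
  if [pick z : Z | (fsval z < y) &&
        [forall z' : Z, (fsval z' < y) ==> (fsval z' <= fsval z)]] is Some z
  then (Z `|` [fset (fsval z - e)%R | e in N])%fset else Z.

Definition pre_refinement X : {fset R} :=
  (X `|` [fset (x - e)%R | x in X, e in distances X])%fset.

Definition Sh X : {fset R} :=
  foldl (refine_step (distances X)) (pre_refinement X)
    (sort >=%R (enum_fset (pre_refinement X))).

End Refinement.

(* Main.v *)
Require Import Defs.
From HB Require Import structures.
From mathcomp Require Import all_boot all_order all_algebra finmap.
From mathcomp Require Import boolp classical_sets reals lra.

Set Implicit Arguments.
Unset Strict Implicit.
Unset Printing Implicit Defensive.

Import Order.TTheory GRing.Theory Num.Theory.

Local Open Scope ring_scope.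

(** The proof of the theorem shows more than the statement: on modules over any
    finite set of reals, the interleaving and the bottleneck metric agree, and
    [j] is a contraction towards every larger set with the same maximum. The
    refinement [Sh X1] is such a set, since it only adds points below existing
    ones, and the third part combines the first two.

    Everything on the metric side rests on one observation: among the
    translations of height at most [e] there is a largest one, [lam e], which
    moves by [e] and rounds down ([le_lam]). As interleavings can be pushed
    along larger translations, [D(M, N) <= e] means that [M] and [N] are
    [(lam e, lam e)]-interleaved ([dI_le]), and a module of width at most [e]
    has zero structure map from [p] to [lam e (lam e p)] ([width_le]).

    An [e]-matching of barcodes therefore gives an interleaving summand by
    summand ([thin_interleaved_matched]); unmatched summands can be mapped to 0.
    For any barcodes this proves [D <= D_B].

    For the converse, both modules are sums of interval modules
    ([decomposition]), and an interleaving has matrix entries with respect to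
    these sums. Call two bars close if their births and their deaths differ by
    at most [e], and a bar long if it survives two applications of [lam e].
    Close bars are at distance at most [e] ([close_dI]), and bars that are not
    long have width at most [e] ([short_width]), so a matching between close
    bars that covers all long bars on both sides is needed. By the theorems of
    Hall and Mendelsohn-Dulmage it is enough that every set [A] of long bars has
    at least [#|A|] bars close to one of its members. This is a count of
    dimensions ([hall_condition]): after discarding the bars that are not close
    to [A], the composite of the two interleaving maps is still unitriangular
    on [A] for the order by the sum of the endpoints. Rounding is harmless here,
    as the condition for a bar to be long is rounded in the same way.

    For the contraction, rounding down from the larger set to [X] restricts the
    modules on [X], extended by 0 on both sides, to their images under [j], and
    interleavings restrict with them ([thin_interleaved_pullback]). *)

(** * Matchings in bipartite graphs *)

(** Rado's argument, by induction on the number of edges. If some vertex [i] has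
    two neighbours [j1] and [j2], one of these edges can be removed: otherwise
    two sets of vertices [A1] and [A2] violate the condition without the one and
    the other edge, and counting the neighbours of [A1 :|: A2] together with
    [i], and those of [A1 :&: A2], contradicts the condition. *)
Lemma hall_marriage (T U : finType) (L : {set T}) (nb : T -> {set U}) :
  (forall A : {set T}, A \subset L -> #|A| <= #|\bigcup_(i in A) nb i|)%N ->
  exists f : T -> option U,
    (forall i, i \in L -> exists2 j, f i = Some j & j \in nb i) /\
    (forall i i' j, i \in L -> i' \in L -> f i = Some j -> f i' = Some j -> i = i').
Proof.
have [n] := ubnP (\sum_i #|nb i|)%N; elim: n nb => // n IHn nb ltn Hall.
case: (pickP [pred i in L | (1 < #|nb i|)%N]) => [i /andP[iL /card_gt1P]|small].
  move=> [j1 [j2 [nb1 nb2 neq]]].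
  pose cut j k := if k == i then nb k :\ j else nb k.
  have cutS j k : cut j k \subset nb k.
    by rewrite /cut; case: ifP => // _; exact: subD1set.
  have cut_smaller j : j \in nb i -> (\sum_k #|cut j k| < n)%N.
    move=> ji; rewrite ltnS in ltn; apply: leq_trans ltn.
    rewrite (bigD1 i) //= [leqRHS](bigD1 i) //=.
    rewrite {1}/cut eqxx (cardsD1 j (nb i)) ji -addSn leq_add //.
    by apply: leq_sum => k _; exact/subset_leq_card/cutS.
  pose good j := forall A : {set T}, A \subset L ->
    (#|A| <= #|\bigcup_(k in A) cut j k|)%N.
  have [[j [ji gj]]|bad] := pselect (exists j, j \in nb i /\ good j).
    have [f [f1 f2]] := IHn (cut j) (cut_smaller j ji) gj.
    exists f; split=> // k /f1[l fk lk]; exists l => //.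
    exact: (fintype.subsetP (cutS j k)) lk.
  have viol j : j \in nb i -> exists A : {set T}, [/\ A \subset L, i \notin A &
      #|(\bigcup_(k in A) nb k) :|: (nb i :\ j)| <= #|A| ]%N.
    move=> ji; have /existsNP[A] : ~ good j by move=> gj; apply: bad; exists j.
    move=> /not_implyP[AL /negP]; rewrite -ltnNge => lt.
    have iA : i \in A.
      apply: contraTT lt => iA; rewrite -leqNgt.
      suff <- : \bigcup_(k in A) nb k = \bigcup_(k in A) cut j k by exact: Hall AL.
      apply: eq_bigr => k kA; rewrite /cut.
      by case: eqP => // ki; rewrite -ki kA in iA.
    exists (A :\ i); split; first exact: fintype.subset_trans (subD1set _ _) AL.
      by rewrite !inE eqxx.
    rewrite (cardsD1 i A) iA ltnS (big_setD1 i) //= {1}/cut eqxx finset.setUC in lt.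
    suff -> : \bigcup_(k in A :\ i) nb k = \bigcup_(k in A :\ i) cut j k by [].
    by apply: eq_bigr => k; rewrite /cut !inE => /andP[/negPf->].
  have [A1 [A1L iA1 c1]] := viol j1 nb1.
  have [A2 [A2L iA2 c2]] := viol j2 nb2.
  set X1 := (\bigcup_(k in A1) nb k) :|: (nb i :\ j1) in c1.
  set X2 := (\bigcup_(k in A2) nb k) :|: (nb i :\ j2) in c2.
  have i12 : i \notin A1 :|: A2 by rewrite inE negb_or iA1 iA2.
  have hU : (#|A1 :|: A2|.+1 <= #|X1 :|: X2|)%N.
    have := Hall (i |: (A1 :|: A2)); rewrite cardsU1 i12 => H.
    apply: leq_trans (H _) _; first by rewrite !finset.subUset finset.sub1set iL A1L.
    apply/subset_leq_card/finset.bigcupsP => k; rewrite !inE => /predU1P[->|kA].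
      apply/fintype.subsetP => j ji; rewrite !inE ji !andbT.
      by case: (eqVneq j j1) => [->|]; rewrite ?neq ?orbT.
    by case/orP: kA => kA; apply/fintype.subsetP => j jk;
      rewrite !inE; apply/orP; [left|right]; apply/orP; left; apply/finset.bigcupP; exists k.
  have hI : (#|A1 :&: A2| <= #|X1 :&: X2|)%N.
    apply: leq_trans (Hall _ _) _; first by rewrite finset.subIset // A1L.
    apply/subset_leq_card/finset.bigcupsP => k; rewrite !inE => /andP[k1 k2].
    apply/fintype.subsetP => j jk; rewrite !inE; apply/andP.
    by split; apply/orP; left; apply/finset.bigcupP; exists k.
  move: (leq_add hU hI); rewrite addSn !cardsUI => lt.
  by move: (leq_trans lt (leq_add c1 c2)); rewrite ltnn.
exists (fun i => [pick j in nb i]).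
have nonempty i : i \in L -> exists j, nb i = [set j].
  move=> iL; apply/cards1P; rewrite eqn_leq leqNgt.
  move: (small i) => /=; rewrite iL /= => -> /=.
  by have := Hall [set i]; rewrite cards1 big_set1; apply; rewrite finset.sub1set.
split=> [i iL|i i' j iL i'L].
  have [j nbi] := nonempty i iL.
  by case: pickP => [k ki|/(_ j)]; [exists k|rewrite nbi finset.set11].
case: pickP => // k + [kj]; rewrite {k}kj => ji.
case: pickP => // k + [kj]; rewrite {k}kj => ji'.
apply/eqP; apply: contraT => ii'.
have := Hall [set i; i'].
rewrite cards2 ii' finset.big_setU1 ?inE //= big_set1.
have [k nbi] := nonempty i iL; have [k' nbi'] := nonempty i' i'L.
move: ji ji'; rewrite nbi nbi' !inE => /eqP <- /eqP <-; rewrite finset.setUid cards1.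
by rewrite finset.subUset !finset.sub1set iL i'L => /(_ isT).
Qed.

(** As in the proof of the Cantor-Bernstein theorem: follow [f] on the paths
    that start at a vertex of [L] outside the image of [g] and apply [f] and [g]
    alternately, and the inverse of [g] everywhere else. *)
Lemma mendelsohn_dulmage (T U : finType) (e : T -> U -> Prop)
    (L : {set T}) (L' : {set U}) (f : T -> option U) (g : U -> option T) :
  (forall i, i \in L -> exists2 j, f i = Some j & e i j) ->
  (forall i i' j, i \in L -> i' \in L -> f i = Some j -> f i' = Some j -> i = i') ->
  (forall j, j \in L' -> exists2 i, g j = Some i & e i j) ->
  (forall j j' i, j \in L' -> j' \in L' -> g j = Some i -> g j' = Some i -> j = j') ->
  exists h : T -> option U,
   [/\ forall i i' j, h i = Some j -> h i' = Some j -> i = i',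
     forall i, i \in L -> exists j, h i = Some j,
     forall j, j \in L' -> exists i, h i = Some j &
     forall i j, h i = Some j -> e i j].
Proof.
move=> fe f_inj ge g_inj.
pose ing i := [exists j in L', g j == Some i].
pose step i i' := (i \in L) && [exists j in L', (f i == Some j) && (g j == Some i')].
pose C i := [exists i0, [&& i0 \in L, ~~ ing i0 & connect step i0 i]].
have C_step i i' : C i -> step i i' -> C i'.
  move=> /existsP[i0 /and3P[i0L i0g c]] s; apply/existsP; exists i0.
  by rewrite i0L i0g (connect_trans c (connect1 s)).
have C_inv i : C i -> ing i -> exists2 i', C i' & step i' i.
  move=> /existsP[i0 /and3P[i0L i0g /connectP[p]]].
  case/lastP: p => [_ ->|p i'] /=; first by move: i0g => /negP.
  rewrite rcons_path last_rcons => /andP[pth s] -> _.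
  exists (last i0 p) => //; apply/existsP; exists i0; rewrite i0L i0g.
  by apply/connectP; exists p.
pose h i := if C i && (i \in L) then f i else
            if C i then None else [pick j in L' | g j == Some i].
have hC i j : C i -> h i = Some j -> i \in L /\ f i = Some j.
  by rewrite /h => ->; case: ifP.
have hN i j : ~~ C i -> h i = Some j -> j \in L' /\ g j = Some i.
  by rewrite /h => /negPf ->; case: pickP => //= k /andP[kL /eqP gk] [<-].
have mixed i i' j : C i -> ~~ C i' -> h i = Some j -> h i' <> Some j.
  move=> Ci Ci' /(hC _ _ Ci)[iL fi] /(hN _ _ Ci')[jL gj].
  move/negP: Ci'; apply; apply: (C_step i) => //; rewrite /step iL.
  by apply/existsP; exists j; rewrite jL fi gj !eqxx.
exists h; split.
- move=> i i' j hi hi'.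
  case: (boolP (C i)) => Ci; case: (boolP (C i')) => Ci'.
  + have [iL fi] := hC _ _ Ci hi; have [iL' fi'] := hC _ _ Ci' hi'.
    exact: f_inj fi fi'.
  + by case: (mixed _ _ _ Ci Ci' hi hi').
  + by case: (mixed _ _ _ Ci' Ci hi' hi).
  + have [jL gj] := hN _ _ Ci hi; have [_ gj'] := hN _ _ Ci' hi'.
    by move: gj; rewrite gj' => -[].
- move=> i iL; rewrite /h iL andbT; case: (boolP (C i)) => Ci.
    by have [j fi _] := fe i iL; exists j.
  case: pickP => [j _|none]; first by exists j.
  move/negP: Ci; case; apply/existsP; exists i; rewrite iL connect0 andbT /=.
  by apply/existsP => -[j jj]; move: (none j); rewrite jj.
- move=> j jL; have [i gj eij] := ge j jL; case: (boolP (C i)) => Ci.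
    have [|i' Ci' /andP[i'L /existsP[j' /and3P[j'L /eqP fi' /eqP gj']]]] := C_inv i Ci.
      by apply/existsP; exists j; rewrite jL gj eqxx.
    by exists i'; rewrite /h Ci' i'L fi' (g_inj j j' i).
  exists i; rewrite /h (negPf Ci) /=; case: pickP => [k /andP[kL /eqP gk]|/(_ j)].
    by rewrite (g_inj k j i).
  by rewrite jL gj eqxx.
- move=> i j hi; case: (boolP (C i)) => Ci.
    have [iL fi] := hC _ _ Ci hi; have [j' fi' eij] := fe i iL.
    by move: fi'; rewrite fi => -[->].
  have [jL gj] := hN _ _ Ci hi; have [i' gj' eij] := ge j jL.
  by move: gj'; rewrite gj => -[->].
Qed.

(** The entries [\sum_(j in B) psi k j * phi j i] form a unitriangular matrix
    for the order by [w], so its factorisation through [B] forces [#|A| <= #|B|].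
    No determinant is needed: a nonzero vector killed by [phi] on [B] would have
    coefficient 0 at the element of its support of largest weight. *)
Lemma card_le_of_triangular (K : fieldType) (R : realDomainType) (T U : finType)
    (A : {set T}) (B : {set U}) (phi : U -> T -> K) (psi : T -> U -> K)
    (w : T -> R) :
  {in A &, forall i k, w i <= w k -> \sum_j psi k j * phi j i = (i == k)%:R} ->
  {in A &, forall i k, w i <= w k ->
    forall j, psi k j * phi j i != 0 -> j \in B} ->
  (#|A| <= #|B|)%N.
Proof.
move=> tri sup; rewrite leqNgt; apply/negP => lt.
pose W : 'M[K]_(#|A|, #|B|) := \matrix_(a, c) phi (enum_val c) (enum_val a).
have kW : kermx W != 0.
  rewrite kermx_eq0 /row_free; apply/negP => /eqP rW.
  by move: (rank_leq_col W); rewrite rW leqNgt lt.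
have := nz_row_eq0 (kermx W); rewrite (negPf kW).
set v := nz_row _ => /negbT v0.
have vW : v *m W = 0.
  by have /sub_kermxP := nz_row_sub (kermx W).
have [a0 va0] : exists a, v 0 a != 0.
  by apply/existsP; apply: contraNT v0 => /existsPn H; apply/eqP/rowP => a;
     rewrite mxE; apply/eqP; move: (H a); rewrite negbK.
have [k vk mx] := @Order.TotalTheory.arg_maxP _ R _ a0
  (fun a => v 0 a != 0) (fun a => w (enum_val a)) va0.
move/negP: vk; apply; apply/eqP.
have: \sum_(j in B) psi (enum_val k) j * \sum_a v 0 a * phi j (enum_val a) = 0.
  apply: big1 => j jB; have := congr1 (fun m : 'rV_ _ => m 0 (enum_rank_in jB j)) vW.
  rewrite !mxE => H; rewrite -[RHS](mulr0 (psi (enum_val k) j)); congr (_ * _).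
  by rewrite -[RHS]H; apply: eq_bigr => a _; rewrite mxE enum_rankK_in.
under eq_bigr do rewrite mulr_sumr; rewrite exchange_big /=.
rewrite (bigD1 k) //= [X in _ + X]big1 ?addr0 => [|a ak]; last first.
  have [->|va] := eqVneq (v 0 a) 0; first by apply: big1 => j _; rewrite mul0r mulr0.
  under eq_bigr do rewrite mulrCA; rewrite -mulr_sumr.
  have le := mx a va.
  have := tri _ _ (enum_valP a) (enum_valP k) le.
  rewrite (inj_eq enum_val_inj) (negPf ak) (bigID (mem B)) /=.
  rewrite [X in _ + X]big1 ?addr0 => [->|j jB]; first by rewrite mulr0.
  by apply/eqP; apply: contraNT jB; exact: (sup _ _ (enum_valP a) (enum_valP k) le).
under eq_bigr do rewrite mulrCA; rewrite -mulr_sumr.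
have le : w (enum_val k) <= w (enum_val k) by [].
have := tri _ _ (enum_valP k) (enum_valP k) le.
rewrite eqxx (bigID (mem B)) /= [X in _ + X]big1 ?addr0 => [->|j jB].
  by rewrite mulr1.
by apply/eqP; apply: contraNT jB; exact: (sup _ _ (enum_valP k) (enum_valP k) le).
Qed.

(** * Functors on thin categories *)

Lemma dep_choice (T : Type) (B : T -> Type) (P : forall x, B x -> Prop) :
  (forall x, exists y, P x y) -> exists f : forall x, B x, forall x, P x (f x).
Proof.
by move=> H; exists (fun x => projT1 (cid (H x))) => x; exact: projT2 (cid (H x)).
Qed.

Lemma lfun_of_linear (K : fieldType) (U V : vectType K) (f : U -> V) :
  linear f -> exists g : 'Hom(U, V), g =1 f.
Proof.
move=> lf; pose fL : {linear U -> V} := HB.pack f (GRing.isLinear.Build K U V _ f lf).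
by exists (linfun fL) => u; rewrite lfunE.
Qed.

Lemma lfun_sum (K : fieldType) (U V : vectType K) (f : 'Hom(U, V)) I (s : seq I)
  (P : pred I) (E : I -> U) : f (\sum_(i <- s | P i) E i) = \sum_(i <- s | P i) f (E i).
Proof. exact: linear_sum. Qed.

Lemma lfunZ (K : fieldType) (U V : vectType K) (f : 'Hom(U, V)) a u :
  f (a *: u) = a *: f u.
Proof. exact: linearZ. Qed.

Section Functors.
Variables (K : fieldType) (T : Type) (r : rel T).
Implicit Types M N : pfun K r.

Lemma mor_of_linear M N (f : forall p, M p -> N p) :
  (forall p, linear (f p)) ->
  (forall p q (h : r p q) u, mp N h (f p u) = f q (mp M h u)) ->
  exists g : mor M N, forall p, g p =1 f p.
Proof.
move=> lf nf; have [g gE] := dep_choice (fun p => lfun_of_linear (lf p)).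
have ng p q (h : r p q) : (mp N h \o g p)%VF = (g q \o mp M h)%VF.
  by apply/lfunP => u; rewrite !comp_lfunE !gE.
by exists (Mor ng).
Qed.

Lemma mp_irr M p q (h h' : r p q) : mp M h = mp M h'.
Proof. by congr mp; exact: bool_irrelevance. Qed.

Lemma mp1 M p (h : r p p) u : mp M h u = u.
Proof. by rewrite mp_id id_lfunE. Qed.

Lemma mpK M p q s (hpq : r p q) (hqs : r q s) (hps : r p s) u :
  mp M hqs (mp M hpq u) = mp M hps u.
Proof. by rewrite (mp_comp M hpq hqs hps) comp_lfunE. Qed.

Lemma mor_mp M N (f : mor M N) p q (h : r p q) u :
  f q (mp M h u) = mp N h (f p u).
Proof. by rewrite -!comp_lfunE cmp_nat. Qed.

Lemma mor_comp M N P (f : mor M N) (g : mor N P) :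
  exists k : mor M P, forall p u, k p u = g p (f p u).
Proof.
apply: mor_of_linear => [p a u v|p q h u]; first by rewrite !linearP.
by rewrite !mor_mp.
Qed.

Lemma isoP M N : iso M N <-> exists (f : mor M N) (g : mor N M),
  (forall p u, g p (f p u) = u) /\ (forall p u, f p (g p u) = u).
Proof.
split=> -[f [g [fg gf]]]; exists f, g; split=> p.
- by move=> u; rewrite -comp_lfunE fg id_lfunE.
- by move=> u; rewrite -comp_lfunE gf id_lfunE.
- by apply/lfunP => u; rewrite comp_lfunE fg id_lfunE.
- by apply/lfunP => u; rewrite comp_lfunE gf id_lfunE.
Qed.

Lemma iso_trans M N P : iso M N -> iso N P -> iso M P.
Proof.
move=> /isoP[f [f' [ff' f'f]]] /isoP[g [g' [gg' g'g]]].
have [k kE] := mor_comp f g; have [k' k'E] := mor_comp g' f'.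
by apply/isoP; exists k, k'; split=> p u; rewrite kE k'E ?gg' ?ff' ?f'f ?g'g.
Qed.

Lemma is_zeroP M : is_zero M <-> forall p (u : M p), u = 0.
Proof.
split=> [/isoP[f [g [fg _]]] p u|M0].
  by rewrite -(fg p u) (_ : f p u = 0) ?linear0 //; exact: thinmx0.
have [f fE] : exists f : mor M (zero_pfun K r), forall p, f p =1 fun=> 0.
  apply: mor_of_linear => [p a u v|p q h u]; last exact: thinmx0.
  by rewrite scaler0 addr0.
have [g gE] : exists g : mor (zero_pfun K r) M, forall p, g p =1 fun=> 0.
  apply: mor_of_linear => [p a u v|p q h u]; last by rewrite linear0.
  by rewrite scaler0 addr0.
apply/isoP; exists f, g; split=> p u; first by rewrite gE [RHS]M0.
exact: etrans (thinmx0 _) (esym (thinmx0 _)).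
Qed.

(** ** Biproducts *)

(** Inclusions and projections are what every argument about a barcode uses:
    they give a morphism between two sums its matrix entries, and assemble
    morphisms between summands into a morphism of the sums. *)
Definition biproduct M n (S : 'I_n -> pfun K r) : Prop :=
  exists (inj : forall i, mor (S i) M) (prj : forall i, mor M (S i)),
  [/\ forall i p u, prj i p (inj i p u) = u,
      forall i j p u, i != j -> prj j p (inj i p u) = 0 &
      forall p u, \sum_i inj i p (prj i p u) = u].

(** The first summand of [dsum] is treated apart from the others, while the
    families of morphisms out of and into the summands are dependent. *)
Definition ord_case n (P : 'I_n.+1 -> Type) (P0 : P ord0)
    (PS : forall j, P (lift ord0 j)) (i : 'I_n.+1) : P i :=
  match unliftP ord0 i with
  | UnliftSome j e => eq_rect_r P (PS j) e
  | UnliftNone e => eq_rect_r P P0 e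
  end.

Lemma ord_case0 n P P0 PS : @ord_case n P P0 PS ord0 = P0.
Proof.
rewrite /ord_case; case: unliftP => [j e|e]; first by move/eqP: (neq_lift ord0 j).
by rewrite (eq_axiomK e).
Qed.

Lemma ord_caseS n P P0 PS j : @ord_case n P P0 PS (lift ord0 j) = PS j.
Proof.
rewrite /ord_case; case: unliftP => [k e|e]; last first.
  by move/eqP: (neq_lift ord0 j); case; exact: esym.
by have jk := lift_inj e; case: _ / jk e => e; rewrite (eq_axiomK e).
Qed.

Lemma biproduct_iso M N n (S : 'I_n -> pfun K r) :
  iso M N -> biproduct N S -> biproduct M S.
Proof.
move=> /isoP[f [g [fg gf]]] [inj [prj [pi1 pi0 sum1]]].
have [inj' injE] := dep_choice (fun i => mor_comp (inj i) g).
have [prj' prjE] := dep_choice (fun i => mor_comp f (prj i)).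
exists inj', prj'; split=> [i p u|i j p u ij|p u].
- by rewrite injE prjE gf pi1.
- by rewrite injE prjE gf pi0.
- under eq_bigr do rewrite injE prjE.
  by rewrite -lfun_sum sum1 fg.
Qed.

Lemma biproduct_dsum n (S : 'I_n -> pfun K r) : biproduct (dsum S) S.
Proof.
elim: n S => [|n IHn] S.
  have inj (i : 'I_0) : mor (S i) (dsum S) by case: i.
  have prj (i : 'I_0) : mor (dsum S) (S i) by case: i.
  exists inj, prj; split; [by case|by case|] => p u.
  exact: etrans (thinmx0 _) (esym (thinmx0 _)).
have [inj [prj [pi1 pi0 sum1]]] := IHn (fun i => S (lift ord0 i)).
set D := dsum _ in inj prj pi1 pi0 sum1.
have [i1 i1E] : exists f : mor (S ord0) (dsum S), forall p u, f p u = (u, 0).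
  apply: mor_of_linear => [p a u v|p q h u].
    by congr pair; rewrite /= scaler0 addr0.
  by rewrite lfunE /= /sum_fun /= linear0.
have /dep_choice[i2 i2E] : forall j, exists f : mor (S (lift ord0 j)) (dsum S),
    forall p u, f p u = (0, inj j p u).
  move=> j; apply: mor_of_linear => [p a u v|p q h u].
    by congr pair; rewrite /= ?linearP ?scaler0 ?addr0.
  by rewrite lfunE /= /sum_fun /= linear0 mor_mp.
have [p1 p1E] : exists f : mor (dsum S) (S ord0), forall p u, f p u = u.1.
  by apply: mor_of_linear => // p q h u; rewrite lfunE.
have /dep_choice[p2 p2E] : forall j, exists f : mor (dsum S) (S (lift ord0 j)),
    forall p u, f p u = prj j p u.2.
  move=> j; apply: mor_of_linear => [p a u v|p q h u]; first by rewrite linearP.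
  by rewrite lfunE /= mor_mp.
exists (ord_case (P := fun i => mor (S i) (dsum S)) i1 i2).
exists (ord_case (P := fun i => mor (dsum S) (S i)) p1 p2); split.
- move=> i p; case: (unliftP ord0 i) => [j ->|->] u.
    by rewrite !ord_caseS p2E i2E pi1.
  by rewrite !ord_case0 p1E i1E.
- move=> i i' p u; move: u; case: (unliftP ord0 i) => [j ->|->] u;
    case: (unliftP ord0 i') => [j' ->|->] ne.
  + by rewrite !ord_caseS p2E i2E pi0 // -(inj_eq (@lift_inj _ ord0)).
  + by rewrite ord_case0 ord_caseS p1E i2E.
  + by rewrite ord_caseS ord_case0 p2E i1E linear0.
  + by rewrite eqxx in ne.
- move=> p u; rewrite big_ord_recl !ord_case0 i1E p1E.
  under eq_bigr do rewrite !ord_caseS i2E p2E.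
  suff -> : \sum_(i < n) (0, inj i p (prj i p u.2)) = (0, u.2) :> sum_ob (S ord0) D p.
    by case: u => a b; congr pair; rewrite /= ?addr0 ?add0r.
  apply: etrans (congr1 (fun v : D p => (0, v) : sum_ob (S ord0) D p) (sum1 p u.2)).
  elim/big_rec2: _ => // i a b _ ->.
  by congr pair; rewrite /= addr0.
Qed.

End Functors.

(** * Interleavings over a thin category *)

(** Interleavings along arbitrary maps of the index set, with the squares
    required for every proof of the order relations involved, so that no
    monotonicity is bundled with [L] and [G]. *)
Definition thin_interleaved (K : fieldType) (T : Type) (r : rel T) (L G : T -> T)
    (M N : pfun K r) : Prop :=
  exists (phi : forall p, 'Hom(M p, N (L p))) (psi : forall p, 'Hom(N p, M (G p))),
  [/\ forall p q (h : r p q) (h' : r (L p) (L q)) u,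
        mp N h' (phi p u) = phi q (mp M h u),
      forall p q (h : r p q) (h' : r (G p) (G q)) u,
        mp M h' (psi p u) = psi q (mp N h u),
      forall p (h : r p (G (L p))) u, psi (L p) (phi p u) = mp M h u &
      forall p (h : r p (L (G p))) u, phi (G p) (psi p u) = mp N h u].

Lemma thin_interleaved_iso (K : fieldType) (T : Type) (r : rel T) (L G : T -> T)
    (M M' N N' : pfun K r) :
  iso M M' -> iso N N' -> thin_interleaved L G M N -> thin_interleaved L G M' N'.
Proof.
move=> /isoP[f [f' [ff' f'f]]] /isoP[g [g' [gg' g'g]]] [phi [psi [n1 n2 c1 c2]]].
exists (fun p => (g (L p) \o phi p \o f' p)%VF).
exists (fun p => (f (G p) \o psi p \o g' p)%VF).
split=> p => [q h h'|q h h'|h|h] u; rewrite !comp_lfunE.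
- by rewrite -mor_mp n1 mor_mp.
- by rewrite -mor_mp n2 mor_mp.
- by rewrite gg' c1 mor_mp f'f.
- by rewrite ff' c2 mor_mp g'g.
Qed.

(** Interleavings restrict along [F] provided the translations on the source
    move at least as far. With [F] the identity this enlarges the translations,
    with [F] the rounding of a larger set to a smaller one it gives the
    contraction property of [j]. *)
Lemma thin_interleaved_pullback (K : fieldType) (S T : Type) (rS : rel S) (rT : rel T)
    (F : S -> T) (Fh : forall p q, rS p q -> rT (F p) (F q))
    (L G : T -> T) (L' G' : S -> S) (M N : pfun K rT) :
  transitive rT ->
  (forall p q, rT p q -> rT (L p) (L q)) -> (forall p q, rT p q -> rT (G p) (G q)) ->
  (forall p, rT p (L p)) -> (forall p, rT p (G p)) ->
  (forall p q, rS p q -> rS (L' p) (L' q)) ->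
  (forall p q, rS p q -> rS (G' p) (G' q)) ->
  (forall p, rT (L (F p)) (F (L' p))) -> (forall p, rT (G (F p)) (F (G' p))) ->
  thin_interleaved L G M N -> thin_interleaved L' G' (pullback Fh M) (pullback Fh N).
Proof.
move=> tr Lh Gh Lge Gge Lh' Gh' LF GF [phi [psi [n1 n2 c1 c2]]].
exists (fun p => (mp N (LF p) \o phi (F p))%VF).
exists (fun p => (mp M (GF p) \o psi (F p))%VF).
split=> p => [q h h'|q h h'|h|h] u; rewrite !comp_lfunE /=.
- have hm : rT (L (F p)) (F (L' q)) by exact: (tr _ _ _ (LF p) (Fh _ _ h')).
  by rewrite (mpK _ _ hm) -(n1 _ _ (Fh _ _ h) (Lh _ _ (Fh _ _ h))) (mpK _ _ hm).
- have hm : rT (G (F p)) (F (G' q)) by exact: (tr _ _ _ (GF p) (Fh _ _ h')).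
  by rewrite (mpK _ _ hm) -(n2 _ _ (Fh _ _ h) (Gh _ _ (Fh _ _ h))) (mpK _ _ hm).
- rewrite -(n2 _ _ (LF p) (Gh _ _ (LF p))) (c1 _ (tr _ _ _ (Lge _) (Gge _))).
  have hm : rT (F p) (G (F (L' p)))
    by exact: (tr _ _ _ (tr _ _ _ (Lge _) (LF p)) (Gge _)).
  by rewrite (mpK _ _ hm) (mpK _ _ (Fh _ _ h)).
- rewrite -(n1 _ _ (GF p) (Lh _ _ (GF p))) (c2 _ (tr _ _ _ (Gge _) (Lge _))).
  have hm : rT (F p) (L (F (G' p)))
    by exact: (tr _ _ _ (tr _ _ _ (Gge _) (GF p)) (Lge _)).
  by rewrite (mpK _ _ hm) (mpK _ _ (Fh _ _ h)).
Qed.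

Lemma thin_interleaved_mono (K : fieldType) (T : Type) (r : rel T) (L G L' G' : T -> T)
    (M N : pfun K r) :
  transitive r ->
  (forall p q, r p q -> r (L p) (L q)) -> (forall p q, r p q -> r (G p) (G q)) ->
  (forall p, r p (L p)) -> (forall p, r p (G p)) ->
  (forall p q, r p q -> r (L' p) (L' q)) -> (forall p q, r p q -> r (G' p) (G' q)) ->
  (forall p, r (L p) (L' p)) -> (forall p, r (G p) (G' p)) ->
  thin_interleaved L G M N -> thin_interleaved L' G' M N.
Proof.
move=> tr Lh Gh Lge Gge Lh' Gh' LL GG.
exact: (@thin_interleaved_pullback _ _ _ r r id (fun _ _ h => h) L G L' G' M N).
Qed.

Section Matched.
Variables (K : fieldType) (T : Type) (r : rel T).

(** One of the two composites of an interleaving assembled from a matching;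
    the other one is the same statement with the roles exchanged. A summand
    without partner contributes nothing to the composite, hence must contribute
    nothing to the structure map either. *)
Lemma matched_composite (M N : pfun K r) m n (S : 'I_m -> pfun K r)
    (S' : 'I_n -> pfun K r) (e : 'I_m -> 'I_n -> bool) (q s : T) (p : T)
    (injS : forall i, mor (S i) M) (prjS : forall i, mor M (S i))
    (injT : forall j, mor (S' j) N) (prjT : forall j, mor N (S' j))
    (phi : forall i j, 'Hom(S i p, S' j q)) (psi : forall i j, 'Hom(S' j q, S i s))
    (h : r p s) :
  (forall i i' j, e i j -> e i' j -> i = i') ->
  (forall i j j', e i j -> e i j' -> j = j') ->
  (forall p u, \sum_i injS i p (prjS i p u) = u) ->
  (forall j p u, prjT j p (injT j p u) = u) ->
  (forall j j' p u, j != j' -> prjT j' p (injT j p u) = 0) ->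
  (forall i j, e i j -> forall u, psi i j (phi i j u) = mp (S i) h u) ->
  (forall i, (forall j, ~~ e i j) -> forall u, mp (S i) h u = 0) ->
  forall u, \sum_i \sum_(j | e i j) injS i s (psi i j (prjT j q
     (\sum_i' \sum_(j' | e i' j') injT j' q (phi i' j' (prjS i' p u))))) = mp M h u.
Proof.
move=> e_inj e_fun sumS p1 p0 comp unm u.
rewrite -[in RHS](sumS p u) lfun_sum; apply: eq_bigr => i _.
have [[j eij]|none] := pselect (exists j, e i j); last first.
  have ne j : ~~ e i j by apply/negP => eij; apply: none; exists j.
  rewrite -mor_mp unm // linear0 big1 // => j eij.
  by move/negP: (ne j).
rewrite (bigD1 j) //= [X in _ + X]big1 ?addr0 => [|j' /andP[eij' jj']]; last first.
  by rewrite (e_fun _ _ _ eij eij') eqxx in jj'.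
rewrite -mor_mp -(comp i j eij); congr (injS i s (psi i j _)).
rewrite lfun_sum (bigD1 i) //= [X in _ + X]big1 ?addr0 => [|i' ii']; last first.
  rewrite lfun_sum big1 //= => j' eij'; apply: p0; apply: contraNneq ii' => jj'.
  by rewrite jj' in eij'; rewrite (e_inj _ _ _ eij eij').
rewrite lfun_sum (bigD1 j) //= [X in _ + X]big1 ?addr0 ?p1 // => j' /andP[_ jj'].
exact: p0.
Qed.

Lemma thin_interleaved_matched (M N : pfun K r) m n (S : 'I_m -> pfun K r)
    (S' : 'I_n -> pfun K r) (f : 'I_m -> option 'I_n) (L G : T -> T) :
  biproduct M S -> biproduct N S' ->
  (forall p q, r p q -> r (L p) (L q)) -> (forall p q, r p q -> r (G p) (G q)) ->
  (forall i i' j, f i = Some j -> f i' = Some j -> i = i') ->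
  (forall i j, f i = Some j -> thin_interleaved L G (S i) (S' j)) ->
  (forall i, f i = None -> forall p (h : r p (G (L p))) u, mp (S i) h u = 0) ->
  (forall j, (forall i, f i <> Some j) -> forall p (h : r p (L (G p))) u,
     mp (S' j) h u = 0) ->
  thin_interleaved L G M N.
Proof.
move=> [injS [prjS [pS1 pS0 sumS]]] [injT [prjT [pT1 pT0 sumT]]] Lh Gh f_inj.
move=> matched unS unT; pose e i j := f i == Some j.
have /dep_choice[phi Hphi] :
  forall ij : 'I_m * 'I_n,
  exists phi : forall p, 'Hom(S ij.1 p, S' ij.2 (L p)), e ij.1 ij.2 ->
  exists psi : forall p, 'Hom(S' ij.2 p, S ij.1 (G p)),
  [/\ forall p q (h : r p q) (h' : r (L p) (L q)) u,
        mp (S' ij.2) h' (phi p u) = phi q (mp (S ij.1) h u),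
      forall p q (h : r p q) (h' : r (G p) (G q)) u,
        mp (S ij.1) h' (psi p u) = psi q (mp (S' ij.2) h u),
      forall p (h : r p (G (L p))) u, psi (L p) (phi p u) = mp (S ij.1) h u &
      forall p (h : r p (L (G p))) u, phi (G p) (psi p u) = mp (S' ij.2) h u].
  move=> [i j]; rewrite /e /=; case: (f i =P Some j) => [/matched[phi H]|_].
    by exists phi.
  by exists (fun=> 0).
have /dep_choice[psi Hpsi] :
  forall ij : 'I_m * 'I_n,
  exists psi : forall p, 'Hom(S' ij.2 p, S ij.1 (G p)), e ij.1 ij.2 ->
  [/\ forall p q (h : r p q) (h' : r (L p) (L q)) u,
        mp (S' ij.2) h' (phi ij p u) = phi ij q (mp (S ij.1) h u),
      forall p q (h : r p q) (h' : r (G p) (G q)) u,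
        mp (S ij.1) h' (psi p u) = psi q (mp (S' ij.2) h u),
      forall p (h : r p (G (L p))) u, psi (L p) (phi ij p u) = mp (S ij.1) h u &
      forall p (h : r p (L (G p))) u, phi ij (G p) (psi p u) = mp (S' ij.2) h u].
  move=> ij; case: (boolP (e ij.1 ij.2)) => [/Hphi[psi H]|_].
    by exists psi.
  by exists (fun=> 0).
have e_inj i i' j : e i j -> e i' j -> i = i' by move=> /eqP fi /eqP; exact: f_inj.
have e_fun i j j' : e i j -> e i j' -> j = j' by move=> /eqP fi /eqP; rewrite fi => -[].
have unS' i (ne : forall j, ~~ e i j) p (h : r p (G (L p))) u : mp (S i) h u = 0.
  by apply: unS; case fi: (f i) => [j|//]; move: (ne j); rewrite /e fi eqxx.
have unT' j (ne : forall i, ~~ e i j) p (h : r p (L (G p))) u : mp (S' j) h u = 0.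
  by apply: unT => i fi; move: (ne i); rewrite /e fi eqxx.
have /dep_choice[Phi PhiE] : forall p, exists Phi : 'Hom(M p, N (L p)), forall u,
    Phi u = \sum_i \sum_(j | e i j) injT j (L p) (phi (i, j) p (prjS i p u)).
  move=> p; apply: lfun_of_linear => a u v; rewrite scaler_sumr -big_split /=.
  apply: eq_bigr => i _; rewrite scaler_sumr -big_split /=.
  by apply: eq_bigr => j _; rewrite !linearP.
have /dep_choice[Psi PsiE] : forall p, exists Psi : 'Hom(N p, M (G p)), forall u,
    Psi u = \sum_j \sum_(i | e i j) injS i (G p) (psi (i, j) p (prjT j p u)).
  move=> p; apply: lfun_of_linear => a u v; rewrite scaler_sumr -big_split /=.
  apply: eq_bigr => j _; rewrite scaler_sumr -big_split /=.
  by apply: eq_bigr => i _; rewrite !linearP.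
exists Phi, Psi; split=> p => [q h h'|q h h'|h|h] u.
- rewrite !PhiE lfun_sum; apply: eq_bigr => i _.
  rewrite lfun_sum; apply: eq_bigr => j /(Hpsi (i, j))[n1 _ _ _].
  by rewrite mor_mp -n1 mor_mp.
- rewrite !PsiE lfun_sum; apply: eq_bigr => j _.
  rewrite lfun_sum; apply: eq_bigr => i /(Hpsi (i, j))[_ n2 _ _].
  by rewrite mor_mp -n2 mor_mp.
- rewrite PsiE PhiE (exchange_big_dep predT) //=.
  apply: (matched_composite (e := e) (injS := injS) (prjS := prjS)
    (injT := injT) (prjT := prjT) (phi := fun i j => phi (i, j) p)
           (psi := fun i j => psi (i, j) (L p))) => //.
  + by move=> i j /(Hpsi (i, j))[_ _ c1 _] v; exact: c1.
  + by move=> i ne v; exact: unS'.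
- rewrite PhiE PsiE (exchange_big_dep predT) //=.
  apply: (matched_composite (e := fun j i => e i j)
    (injS := injT) (prjS := prjT) (injT := injS) (prjT := prjS)
    (phi := fun j i => psi (i, j) p)
           (psi := fun j i => phi (i, j) (G p))) => //.
  + by move=> j j' i /e_fun; apply.
  + by move=> j i i' /e_inj; apply.
  + by move=> j i /(Hpsi (i, j))[_ _ _ c2] v; exact: c2.
  + by move=> j ne v; exact: unT'.
Qed.
End Matched.

(** ** Extension by zero at the top *)

Section TopExt.
Variables (K : fieldType) (T : Type) (r : rel T).
Implicit Types M N : pfun K r.

Lemma top_ext_mor M N (f : mor M N) : exists g : mor (top_ext M) (top_ext N),
  forall x u, g (Some x) u = f x u.
Proof.
pose g (p : option T) : 'Hom(top_ext M p, top_ext N p) :=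
  match p with Some x => f x | None => 0 end.
have gn p q (h : top_rel r p q) :
    (mp (top_ext N) h \o g p)%VF = (g q \o mp (top_ext M) h)%VF.
  case: p q h => [x|] [y|] //= h;
    by first [exact: cmp_nat|exact: homrV0|exact: homrV0l].
by exists (Mor gn).
Qed.

Lemma biproduct_top_ext M n (S : 'I_n -> pfun K r) :
  biproduct M S -> biproduct (top_ext M) (fun i => top_ext (S i)).
Proof.
move=> [inj [prj [pi1 pi0 sum1]]].
have [inj' injE] := dep_choice (fun i => top_ext_mor (inj i)).
have [prj' prjE] := dep_choice (fun i => top_ext_mor (prj i)).
have V0 (u v : 'rV[K]_0) : u = v by rewrite [u]thinmx0 [v]thinmx0.
exists inj', prj'; split=> [i [x|] u|i j [x|] u ij|[x|] u]; try exact: V0.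
- by rewrite prjE injE pi1.
- by rewrite prjE injE pi0.
- by under eq_bigr do rewrite injE prjE; rewrite sum1.
Qed.
End TopExt.

(** * Translations and distances *)

(** The infima in the definitions of the distance and the width are minima, as
    only finitely many values of the height matter. *)
Lemma inf_attained (R : realType) (E : set R) (D : seq R) :
  (exists e, E e) ->
  (forall e, E e -> exists2 e', e' \in D & E e' /\ e' <= e) -> E (inf E).
Proof.
move=> [e0 Ee0] fin.
have min (s : seq R) : (exists2 e, e \in s & E e) ->
    exists2 e, E e & forall e', e' \in s -> E e' -> e <= e'.
  elim: s => [[e]//|a s IHs] [e + Ee]; have [Ea|nEa] := pselect (E a).
    have [/IHs[c Ec cmin] _|none _] := pselect (exists2 e, e \in s & E e).
      exists (Num.min a c); first by rewrite /Num.min; case: ifP.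
      by move=> e' /predU1P[->|/cmin h /h]; rewrite ge_min ?lexx // => ->; rewrite orbT.
    exists a => // e' /predU1P[->//|e's Ee']; case: none; exists e' => //.
  case/predU1P => [ea|es]; first by rewrite -ea in nEa.
  have [|c Ec cmin] := IHs; first by exists e.
  by exists c => // e' /predU1P[->//|]; exact: cmin.
have [|c Ec cmin] := min D; first by have [e' e'D [Ee' _]] := fin _ Ee0; exists e'.
have lbc : lbound E c.
  by move=> e /fin[e' e'D [Ee' le]]; exact: le_trans (cmin _ e'D Ee') le.
suff -> : inf E = c by [].
apply/le_anti; rewrite ge_inf ?lb_le_inf //; first by exists c.
by exists c.
Qed.

Section Metric.
Variables (R : realType) (K : fieldType) (b : R) (X : {fset R}).
Hypothesis b0 : 0 < b.
Variable x0 : X.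
Implicit Types (p q : option X) (M N : pmod K X).
Local Notation le := (leXp X).

Lemma maxXE (x y : X) : maxX x = maxX y.
Proof.
by apply/le_anti; rewrite /maxX; apply/andP; split; apply: bigmax_le => [|i _];
  exact: le_bigmax.
Qed.

(** Realising [P_X^+] isometrically on the real line, with the point at
    infinity at distance [b] above the maximum, turns the metric and the order
    into those of the reals. *)
Definition pos p : R := if p is Some x then fsval x else maxX x0 + b.

Lemma ge_maxX (x : X) : fsval x <= maxX x0.
Proof. exact: le_bigmax. Qed.

Lemma le_pos p q : le p q = (pos p <= pos q).
Proof.
case: p q => [x|] [y|] //=; rewrite /leXp /=; have := b0.
- by move=> ?; apply/esym; move: (ge_maxX x); lra.
- by move=> ?; apply/esym/negbTE; rewrite -ltNge; move: (ge_maxX y); lra.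
- by rewrite lexx.
Qed.

Lemma dist_pos p q : dist b p q = `|pos p - pos q|.
Proof.
case: p q => [x|] [y|] //=; rewrite ?subrr ?normr0 // (maxXE _ x0).
- by rewrite distrC ger0_norm; move: (ge_maxX x) b0; lra.
- by rewrite ger0_norm; move: (ge_maxX y) b0; lra.
Qed.

Lemma leXp_refl p : le p p. Proof. by rewrite le_pos. Qed.
Lemma leXpNone p : le p None. Proof. by case: p. Qed.

(** The largest translation of height at most [e]: by [le_lam] it adds [e] and
    rounds down to a point of [P_X^+]. *)
Definition lam (e : R) p : option X :=
  [arg max_(q > p | pos q <= pos p + e) pos q]%O.

Section Lam.
Variable e : R.
Hypothesis e0 : 0 <= e.

Lemma le_lam q p : le q (lam e p) = (pos q <= pos p + e).
Proof.
rewrite /lam; case: (@Order.TotalTheory.arg_maxP _ R _ p); first by move: e0; lra.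
move=> s sp mx; rewrite le_pos; apply/idP/idP => [qs|/mx//].
exact: le_trans qs sp.
Qed.

Lemma pos_lam p : pos (lam e p) <= pos p + e.
Proof. by rewrite -le_lam leXp_refl. Qed.

Lemma lam_homo p q : le p q -> le (lam e p) (lam e q).
Proof. by rewrite le_lam le_pos => pq; move: (pos_lam p) => ?; lra. Qed.

Lemma lam_ge p : le p (lam e p).
Proof. by rewrite le_lam; move: e0; lra. Qed.

Definition lam_tr : translation X := Translation lam_homo lam_ge.

Lemma height_lam : height b lam_tr <= e.
Proof.
apply: bigmax_le => // p _; rewrite dist_pos distrC ger0_norm.
  by move: (pos_lam p) => /=; lra.
by rewrite subr_ge0 -le_pos lam_ge.
Qed.

Lemma height_le_lam (L : translation X) :
  height b L <= e -> forall p, le (L p) (lam e p).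
Proof.
move=> hL p; rewrite le_lam.
have := le_trans (le_bigmax 0 (fun p => dist b p (L p)) p) hL.
rewrite dist_pos distrC ger0_norm ?subr_ge0 -?le_pos ?tr_ge //; lra.
Qed.
End Lam.

Lemma height_ge0 (L : translation X) : 0 <= height b L.
Proof. exact: bigmax_ge_id. Qed.

Definition dist_values : seq R := 0 :: [seq dist b pq.1 pq.2 | pq : option X * option X].

Lemma height_values (L : translation X) : height b L \in dist_values.
Proof.
apply: (big_ind (fun h => h \in dist_values)).
- exact: mem_head.
- by move=> x y; rewrite /Num.max; case: ifP.
- by move=> p _; rewrite in_cons; apply/orP; right; apply/fintype.imageP; exists (p, L p).
Qed.

Lemma inf_over_translations (P : translation X -> translation X -> Prop) (E : set R) :
  E = [set e | exists L G, [/\ height b L <= e, height b G <= e & P L G]]%classic ->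
  (exists L G, P L G) -> (forall e, E e -> 0 <= e) /\ E (inf E).
Proof.
move=> EE [L [G PLG]].
have E_max (L' G' : translation X) : P L' G' -> E (Num.max (height b L') (height b G')).
  by move=> PLG'; rewrite EE; exists L', G'; rewrite !le_max !lexx orbT.
split=> [e|].
  by rewrite EE => -[L' [G' [hL _ _]]]; exact: le_trans (height_ge0 L') hL.
apply: (@inf_attained _ _ dist_values); first by eexists; exact: E_max PLG.
move=> e; rewrite {1}EE => -[L' [G' [hL hG PLG']]].
exists (Num.max (height b L') (height b G')).
  by rewrite /Num.max; case: ifP => _; exact: height_values.
by split; [exact: E_max|rewrite ge_max hL hG].
Qed.

Definition top_tr : translation X :=
  Translation (tr := fun=> None) (fun _ _ _ => isT) leXpNone.

Lemma interleavedP (G L : translation X) M N :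
  interleaved G L M N <-> thin_interleaved L G (top_ext M) (top_ext N).
Proof.
split=> [[phi [psi [c1 c2]]]|[phi [psi [n1 n2 c1 c2]]]].
  exists phi, psi; split.
  - move=> p q h h' u; rewrite (mp_irr _ h' (tr_homo L h)).
    exact: esym (mor_mp phi h u).
  - move=> p q h h' u; rewrite (mp_irr _ h' (tr_homo G h)).
    exact: esym (mor_mp psi h u).
  - move=> p h u; rewrite (mp_irr _ h (tr_ge2 G L p)) -c1.
    exact: esym (comp_lfunE _ _ _).
  - move=> p h u; rewrite (mp_irr _ h (tr_ge2 L G p)) -c2.
    exact: esym (comp_lfunE _ _ _).
have nphi p q (h : le p q) :
    (mp (shift (top_ext N) L) h \o phi p)%VF = (phi q \o mp (top_ext M) h)%VF.
  by apply/lfunP => u; rewrite !comp_lfunE; exact: n1.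
have npsi p q (h : le p q) :
    (mp (shift (top_ext M) G) h \o psi p)%VF = (psi q \o mp (top_ext N) h)%VF.
  by apply/lfunP => u; rewrite !comp_lfunE; exact: n2.
exists (Mor nphi), (Mor npsi); split=> p; apply/lfunP => u; rewrite comp_lfunE.
  exact: c1.
exact: c2.
Qed.

Lemma dI_le M N (e : R) : dI b M N <= e <->
  0 <= e /\ thin_interleaved (lam e) (lam e) (top_ext M) (top_ext N).
Proof.
have [|E0 Einf] := @inf_over_translations (fun G L => interleaved G L M N) _ erefl.
  exists top_tr, top_tr; apply/interleavedP; exists (fun=> 0), (fun=> 0).
  split=> p => [q h h'|q h h'|h|h] u; rewrite !lfunE /= ?linear0 //;
    apply/esym; exact: thinmx0.
rewrite -/(dI b M N) in Einf.
split=> [le_e|[e0 il]].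
  have e0 : 0 <= e by exact: le_trans (E0 _ Einf) le_e.
  split=> //; move: Einf => -[G [L [hG hL /interleavedP]]].
  have GL := height_le_lam e0 (le_trans hG le_e).
  have LL := height_le_lam e0 (le_trans hL le_e).
  apply: thin_interleaved_mono => //; try exact: tr_homo; try exact: tr_ge; try exact: lam_homo.
  exact: leXp_trans.
apply: ge_inf; first by exists 0 => e' /E0.
exists (lam_tr e0), (lam_tr e0); rewrite height_lam; split=> //.
exact/interleavedP.
Qed.

Lemma dI_ge0 M N : 0 <= dI b M N.
Proof. by have [] := (dI_le M N (dI b M N)).1 (lexx _). Qed.

(** The structure maps form a morphism from [M] to its double translate, so
    vanishing of all such morphisms makes them zero. *)
Lemma width_le M (e : R) : width b M <= e ->
  0 <= e /\ forall p (h : le p (lam e (lam e p))) u, mp (top_ext M) h u = 0.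
Proof.
have [|E0 Einf] := @inf_over_translations (fun L G => 
    hom_zero (top_ext M) (shift (shift (top_ext M) L) G)) _ erefl.
  exists top_tr, top_tr => f p; exact: homrV0.
rewrite -/(width b M) in Einf => le_e.
have e0 : 0 <= e by exact: le_trans (E0 _ Einf) le_e.
split=> // p h u; move: Einf => -[L [G [hL hG hom0]]].
have LL := height_le_lam e0 (le_trans hL le_e).
have GL := height_le_lam e0 (le_trans hG le_e).
have n q s (hqs : le q s) : (mp (shift (shift (top_ext M) L) G) hqs
    \o mp (top_ext M) (tr_ge2 L G q))%VF =
    (mp (top_ext M) (tr_ge2 L G s) \o mp (top_ext M) hqs)%VF.
  have hh : le q (L (G s)) by apply: leXp_trans hqs (tr_ge2 L G s).
  by rewrite -!(mp_comp _ _ _ hh).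
have f0 : mp (top_ext M) (tr_ge2 L G p) = 0 := hom0 (Mor n) p.
have hh : le (L (G p)) (lam e (lam e p)).
  by apply: leXp_trans (LL _) (lam_homo e0 (GL _)).
by rewrite -(mpK (tr_ge2 L G p) hh) f0 lfunE linear0.
Qed.

Lemma width_lam_le M (e : R) (e0 : 0 <= e) :
  hom_zero (top_ext M) (shift (shift (top_ext M) (lam_tr e0)) (lam_tr e0)) ->
  width b M <= e.
Proof.
move=> hom0; apply: ge_inf.
  by exists 0 => e' -[L [G [hL _ _]]]; exact: le_trans (height_ge0 L) hL.
by exists (lam_tr e0), (lam_tr e0); rewrite height_lam.
Qed.
End Metric.

(** * Interval modules *)

Definition bar (R : realType) (X : {fset R}) := (X * option X)%type.

Section Interval.
Variables (R : realType) (K : fieldType) (X : {fset R}) (c : bar X).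
Implicit Types p q : X.
Local Notation x := c.1.
Local Notation y := c.2.

(** Intervals are half-open, [y] being the first point where the module has
    died, with [None] for the module that survives to the maximum: on both ends
    a bound on the endpoints is then a bound on births and deaths. *)
Definition supp (p : option X) : bool := leXp X (Some x) p && ~~ leXp X y p.

Lemma supp_convex (p q s : option X) :
  leXp X p q -> leXp X q s -> supp p -> supp s -> supp q.
Proof.
move=> pq qs /andP[xp _] /andP[_ ys]; apply/andP; split; first exact: leXp_trans xp pq.
by apply: contra ys => yq; exact: leXp_trans yq qs.
Qed.

(** Rows of length 0 or 1 give the two possible values uniformly, so that no
    map has to be defined by cases on the support. *)
Definition itv_ob p : vectType K := 'rV[K]_(supp (Some p)).
Definition itv_mp p q (h : leX X p q) : 'Hom(itv_ob p, itv_ob q) :=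
  linfun (mulmxr (const_mx 1 : 'M[K]_(supp (Some p), supp (Some q)))).

Lemma itv_mp_id p (h : leX X p p) : itv_mp h = \1%VF.
Proof.
apply/lfunP => u; rewrite lfunE id_lfunE /=.
suff -> : const_mx 1 = 1%:M :> 'M[K]_(supp (Some p)) by rewrite mulmx1.
by apply/matrixP; case: (supp _) => -[[|//] i] [[|//] j]; rewrite !mxE.
Qed.

Lemma itv_mp_comp p q s (hpq : leX X p q) (hqs : leX X q s) (hps : leX X p s) :
  itv_mp hps = (itv_mp hqs \o itv_mp hpq)%VF.
Proof.
apply/lfunP => u; rewrite comp_lfunE !lfunE /= -mulmxA; congr (_ *m _).
apply/matrixP => i j; rewrite !mxE.
have pS : supp (Some p) by case: (supp _) i {u} => // -[].
have sS : supp (Some s) by case: (supp _) j {u} => // -[].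
have qS : supp (Some q) by apply: supp_convex pS sS.
under eq_bigr do rewrite !mxE mulr1.
by rewrite sumr_const card_ord qS.
Qed.

Definition itv : pmod K X := PFun itv_mp_id itv_mp_comp.

Definition itv_one p : itv p := const_mx 1.
Definition itv_coef p (u : itv p) : K := \sum_i u 0 i.

Lemma itv_span p (u : itv p) : u = itv_coef u *: itv_one p.
Proof.
rewrite /itv_coef /itv_one; apply/rowP => i; rewrite !mxE mulr1.
move: i u; rewrite /= /itv_ob; case: (supp _) => -[[|//] i] u //.
by rewrite big_ord1; congr (u _ _); exact: val_inj.
Qed.

Lemma itv_coef_one p : itv_coef (itv_one p) = (supp (Some p))%:R.
Proof.
rewrite /itv_coef; under eq_bigr do rewrite mxE.
by rewrite sumr_const card_ord.
Qed.

Lemma itv_coefP p a (u v : itv p) :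
  itv_coef (a *: u + v) = a * itv_coef u + itv_coef v.
Proof.
rewrite /itv_coef mulr_sumr -big_split /=; apply: eq_bigr => i _.
by rewrite !mxE.
Qed.

Lemma itv_mp_one p q (h : leX X p q) : leX X x p -> mp itv h (itv_one p) = itv_one q.
Proof.
move=> xp; rewrite /= lfunE /=; apply/rowP => j; rewrite !mxE.
under eq_bigr do rewrite !mxE mulr1.
rewrite sumr_const card_ord (_ : supp (Some p)) //.
have : supp (Some q) by case: (supp _) j => // -[].
move=> /andP[_ yq]; apply/andP; split=> //; apply: contra yq => yp.
exact: leXp_trans yp (h : leXp X (Some p) (Some q)).
Qed.

Lemma itv_eq0 p (u : itv p) : ~~ supp (Some p) -> u = 0.
Proof.
move=> np; rewrite [u]itv_span [itv_one p]itv_span itv_coef_one (negPf np).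
by rewrite scale0r scaler0.
Qed.

(** ** Their extension to the point at infinity *)

Definition ext : pfun K (leXp X) := top_ext itv.

Definition gen (p : option X) : ext p :=
  match p with Some p' => itv_one p' | None => 0 end.
Definition coeff (p : option X) : ext p -> K :=
  match p with Some p' => fun u => itv_coef u | None => fun=> 0 end.

Lemma gen_span (p : option X) (u : ext p) : u = coeff u *: gen p.
Proof.
case: p u => [p|] u; first exact: itv_span.
by rewrite [LHS]thinmx0 [RHS]thinmx0.
Qed.

Lemma coeff_gen (p : option X) : coeff (gen p) = (supp p)%:R.
Proof. by case: p => [p|] /=; rewrite ?itv_coef_one // /supp; case: y. Qed.

Lemma coeffP (p : option X) a (u v : ext p) : coeff (a *: u + v) = a * coeff u + coeff v.
Proof. by case: p u v => [p|] u v; [exact: itv_coefP|rewrite /= mulr0 addr0]. Qed.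

Lemma coeff0 (p : option X) : coeff (0 : ext p) = 0.
Proof.
by have := coeffP (-1) (0 : ext p) 0; rewrite scaler0 addr0 mulN1r addNr.
Qed.

Lemma coeffZ (p : option X) a (u : ext p) : coeff (a *: u) = a * coeff u.
Proof. by have := coeffP a u 0; rewrite coeff0 !addr0. Qed.

Lemma coeff_sum (p : option X) I (s : seq I) (P : pred I) (E : I -> ext p) :
  coeff (\sum_(i <- s | P i) E i) = \sum_(i <- s | P i) coeff (E i).
Proof.
apply: (big_morph (@coeff p)) => [u v|]; last exact: coeff0.
by have := coeffP 1 u v; rewrite scale1r mul1r.
Qed.

Lemma ext_eq0 (p : option X) (u : ext p) : ~~ supp p -> u = 0.
Proof.
by move=> np; rewrite [u]gen_span [gen p]gen_span coeff_gen (negPf np) scale0r scaler0.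
Qed.

Lemma gen_eq0 (p : option X) : ~~ supp p -> gen p = 0. Proof. exact: ext_eq0. Qed.

Lemma mp_gen (p q : option X) (h : leXp X p q) : leXp X (Some x) p ->
  mp ext h (gen p) = gen q.
Proof.
by case: p q h => [p|] [q|] // h xp; [exact: itv_mp_one|exact: thinmx0|exact: thinmx0].
Qed.

Lemma coeff_mp (p q : option X) (h : leXp X p q) (u : ext p) :
  ~~ leXp X y q -> coeff (mp ext h u) = coeff u.
Proof.
move=> yq; have [sp|np] := boolP (supp p); last first.
  by rewrite (ext_eq0 u np) linear0 !coeff0.
have /andP[xp yp] := sp.
rewrite [u]gen_span lfunZ coeffZ mp_gen // coeffZ !coeff_gen sp.
by rewrite /supp yq (leXp_trans xp h).
Qed.

(** Every element of an interval module comes from the birth [x], where the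
    module is one-dimensional: of two complementary summands, one vanishes
    there, hence everywhere. *)
Lemma itv_summand_zero (B : pmod K X) (s : mor B itv) (g : mor itv B) :
  (forall p u, g p (s p u) = u) -> g x (itv_one x) = 0 -> is_zero B.
Proof.
move=> gs g0; apply/is_zeroP => p u; rewrite -(gs p u).
have [/andP[xp _]|np] := boolP (supp (Some p)); last by rewrite (itv_eq0 (s p u) np) linear0.
have xx : leX X x x by exact: lexx.
rewrite [s p u]itv_span -(itv_mp_one xp xx) lfunZ.
by rewrite mor_mp g0 linear0 scaler0.
Qed.

Definition nonempty_bar : bool := ~~ leXp X y (Some x).

Lemma itv_indecomposable : nonempty_bar -> indecomposable itv.
Proof.
move=> yx; have sx : supp (Some x) by apply/andP; split=> //; exact: lexx.
have one0 : itv_one x != 0.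
  apply: contraTneq sx => e; have := itv_coef_one x.
  rewrite e; have /= := @coeff0 (Some x) => ->; case: (supp _) => // /eqP.
  by rewrite eq_sym oner_eq0.
split=> [/is_zeroP/(_ x (itv_one x))/eqP|A B /isoP[f [g [fg gf]]]].
  by rewrite (negPf one0).
have [pA pAE] : exists k : mor itv A, forall p u, k p u = (f p u).1.
  apply: mor_of_linear => [p a u v|p q h u]; first by rewrite linearP.
  by rewrite mor_mp /= lfunE.
have [pB pBE] : exists k : mor itv B, forall p u, k p u = (f p u).2.
  apply: mor_of_linear => [p a u v|p q h u]; first by rewrite linearP.
  by rewrite mor_mp /= lfunE.
have [iA iAE] : exists k : mor A itv, forall p u, k p u = g p (u, 0).
  apply: mor_of_linear => [p a u v|p q h u].
    by rewrite -linearP; congr (g p _); congr pair; rewrite /= scaler0 addr0.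
  rewrite -mor_mp; congr (g q _); rewrite /= lfunE /= /sum_fun /=.
  by rewrite linear0.
have [iB iBE] : exists k : mor B itv, forall p u, k p u = g p (0, u).
  apply: mor_of_linear => [p a u v|p q h u].
    by rewrite -linearP; congr (g p _); congr pair; rewrite /= scaler0 addr0.
  rewrite -mor_mp; congr (g q _); rewrite /= lfunE /= /sum_fun /=.
  by rewrite linear0.
have AA p u : pA p (iA p u) = u by rewrite pAE iAE gf.
have BB p u : pB p (iB p u) = u by rewrite pBE iBE gf.
have AB p u : pA p (iB p u) = 0 by rewrite pAE iBE gf.
have [a0|aN0] := eqVneq (pA x (itv_one x)) 0.
  by left; exact: itv_summand_zero AA a0.
right; apply: (itv_summand_zero BB).
have := AB x (pB x (itv_one x)).
set w := iB x _; rewrite [w]itv_span lfunZ => /eqP.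
rewrite scaler_eq0 (negPf aN0) orbF => /eqP c0.
by rewrite -(BB x (pB x (itv_one x))) -/w [w]itv_span c0 scale0r linear0.
Qed.

End Interval.
Arguments nonempty_bar {R X} c.

(** * Decomposition into intervals *)

Lemma dim0_eq0 (K : fieldType) (V : vectType K) (u : V) : dim V = 0%N -> u = 0.
Proof.
move=> d0; apply/eqP; rewrite -memv0.
suff -> : (0 = fullv :> {vspace V})%VS by exact: memvf.
by apply/esym/eqP; rewrite -dimv_eq0 dimvf d0.
Qed.

Lemma functional_at (K : fieldType) (V : vectType K) (w : V) :
  w != 0 -> exists l : 'Hom(V, K^o : vectType K), l w = 1.
Proof.
move=> w0; pose B := vbasis (fullv : {vspace V}).
have wB : w = \sum_i coord B i w *: B`_i by rewrite -coord_vbasis ?memvf.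
have [i ci] : exists i, coord B i w != 0.
  apply/existsP; apply: contraNT w0 => /existsPn c0; rewrite wB big1 // => i _.
  by move: (c0 i); rewrite negbK => /eqP ->; rewrite scale0r.
have [l lE] : exists l : 'Hom(V, K^o : vectType K),
    forall u, l u = (coord B i w)^-1 * coord B i u.
  by apply: lfun_of_linear => a u v; rewrite linearP mulrDr mulrCA.
by exists l; rewrite lE mulVf.
Qed.

Lemma split_retract (K : fieldType) (T : Type) (r : rel T) (M I : pfun K r)
    (f : mor I M) (g : mor M I) : (forall p u, g p (f p u) = u) ->
  exists N : pfun K r, [/\ iso M (sum_pfun I N),
    forall p, (dim (N p) <= dim (M p))%N &
    forall p (u : I p), u != 0 -> (dim (N p) < dim (M p))%N].
Proof.
move=> gf; pose U p := lker (g p).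
pose Nob p : vectType K := subvs_of (U p).
have gU p u : u - f p (g p u) \in U p by rewrite memv_ker linearB /= gf subrr.
have mpU p q (h : r p q) u : u \in U p -> mp M h u \in U q.
  by rewrite !memv_ker mor_mp => /eqP ->; rewrite linear0.
have ex p q (h : r p q) : exists m : 'Hom(Nob p, Nob q),
    forall u, m u = vsproj (U q) (mp M h (vsval u)).
  by apply: lfun_of_linear => a u v; rewrite !linearP.
pose Nmp p q h : 'Hom(Nob p, Nob q) := projT1 (cid (ex p q h)).
have NmpE p q (h : r p q) u : vsval (Nmp p q h u) = mp M h (vsval u).
  by rewrite /Nmp (projT2 (cid (ex p q h))) vsprojK // (mpU _ _ h) ?subvsP.
have N1 p (h : r p p) : Nmp p p h = \1%VF.
  by apply/lfunP => u; apply: val_inj; rewrite /= NmpE mp1 id_lfunE.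
have N2 p q s (hpq : r p q) (hqs : r q s) (hps : r p s) :
    Nmp p s hps = (Nmp q s hqs \o Nmp p q hpq)%VF.
  by apply/lfunP => u; apply: val_inj; rewrite /= comp_lfunE !NmpE (mpK _ _ hps).
pose N := PFun N1 N2; exists N.
have dimN p : dim (N p) = \dim (U p) by [].
split=> [|p|p u u0].
- have [to toE] : exists k : mor M (sum_pfun I N),
      forall p u, k p u = (g p u, vsproj (U p) (u - f p (g p u))).
    apply: mor_of_linear => [p a u v|p q h u].
      congr pair; rewrite /= -?linearP //; congr vsproj.
      by rewrite !linearP /= scalerDr addrACA.
    rewrite lfunE; congr pair; rewrite /= ?mor_mp //; apply: val_inj.
    rewrite /= NmpE !vsprojK ?gU //; first exact: linearB.
    by rewrite -linearB (mpU _ _ h) ?gU.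
  have [from fromE] : exists k : mor (sum_pfun I N) M,
      forall p u, k p u = f p u.1 + vsval u.2.
    apply: mor_of_linear => [p a u v|p q h u].
      by rewrite /= !linearP /= scalerDr addrACA.
    by rewrite lfunE /= NmpE linearD mor_mp.
  apply/isoP; exists to, from; split=> p u.
    by rewrite fromE toE /= vsprojK ?gU // addrC subrK.
  have gu : g p (vsval u.2) = 0 by apply/eqP; rewrite -memv_ker subvsP.
  rewrite toE fromE linearD /= gf gu addr0 addrC addKr vsvalK.
  by case: u {gu}.
- by rewrite dimN -(dimvf (M p)); exact/dimvS/subvf.
- rewrite dimN -(dimvf (M p)) ltn_neqAle dimvS ?subvf // andbT.
  apply: contraNN u0; rewrite (dimv_leqif_eq (subvf _)).2 => /eqP UV.
  by rewrite -(gf p u) -memv_ker -/(U p) UV memvf.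
Qed.

Section Decomposition.
Variables (R : realType) (K : fieldType) (b : R) (X : {fset R}).
Hypothesis b0 : 0 < b.
Variable x0 : X.
Implicit Types M : pmod K X.
Local Notation pos := (pos b x0).

(** A vector [v] at the first point [x] where the module is nonzero spans an
    interval, and a functional that is 1 on the last nonzero image of [v],
    pulled back along the structure maps, retracts the module onto it. Nothing
    has to be checked before [x], where there is no nonzero vector. *)
Lemma split_interval M (p : X) (u : M p) : u != 0 ->
  exists c (N : pmod K X), [/\ nonempty_bar c, iso M (sum_pfun (itv K c) N) &
    (\sum_(q : X) dim (N q) < \sum_(q : X) dim (M q))%N].
Proof.
move=> u0.
have dimp : (0 < dim (M p))%N.
  by rewrite lt0n; apply: contraNN u0 => /eqP d0; rewrite (dim0_eq0 u d0).
have [x dimx minx] := @Order.TotalTheory.arg_minP _ R X p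
  (fun q : X => (0 < dim (M q))%N) (fun q : X => fsval q) dimp.
pose v := vpick (fullv : {vspace M x}).
have v0 : v != 0 by rewrite vpick0 -dimv_eq0 dimvf -lt0n.
pose D (q : option X) := leXp X (Some x) q &&
  `[< forall h : leXp X (Some x) q, mp (top_ext M) h v = 0 >].
have DNone : D None by apply/andP; split=> //; apply/asboolP => h; rewrite lfunE.
have [y Dy miny] := @Order.TotalTheory.arg_minP _ R _ None D pos DNone.
have [xy /asboolP y0] := andP Dy.
have xx : leX X x x by exact: lexx.
have yx : nonempty_bar (x, y).
  apply: contra v0 => /= yx.
  have := mpK xy yx (xx : leXp X (Some x) (Some x)) (v : top_ext M (Some x)).
  by rewrite y0 linear0 mp1 => <-.
have sx : supp (x, y) (Some x) by apply/andP.
have [z sz maxz] := @Order.TotalTheory.arg_maxP _ R X x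
  (fun q : X => supp (x, y) (Some q)) (fun q : X => fsval q) sx.
have [xz0 yz] := andP sz; have xz : leX X x z := xz0.
have vz : mp M xz v != 0.
  apply: contraNN yz => /eqP vz0; rewrite (le_pos b0 x0); apply: miny.
  apply/andP; split=> //; apply/asboolP => h; rewrite -vz0.
  by rewrite (mp_irr (top_ext M) h xz).
have [l lz] := functional_at vz.
have /dep_choice[F FE] : forall q, exists a : M q, forall h : leX X x q, a = mp M h v.
  move=> q; have [h|nh] := pselect (leX X x q : Prop).
    by exists (mp M h v) => h'; rewrite (mp_irr _ h h').
  by exists 0 => h; case: nh.
have /dep_choice[G GE] : forall q, exists k : 'Hom(M q, K^o : vectType K),
    forall (h : leX X q z) w, k w = l (mp M h w).
  move=> q; have [h|nh] := pselect (leX X q z : Prop).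
    by exists (l \o mp M h)%VF => h' w; rewrite comp_lfunE (mp_irr _ h h').
  by exists 0 => h; case: nh.
have F_mp q s (h : leX X q s) : leX X x q -> mp M h (F q) = F s.
  move=> xq; have xs : leX X x s by exact: le_trans xq h.
  by rewrite (FE q xq) (FE s xs) (mpK _ _ xs).
have F_dead q : leX X x q -> ~~ supp (x, y) (Some q) -> F q = 0.
  move=> xq; rewrite /supp negb_and negbK => /orP[/negP nq|yq].
    by case: nq.
  rewrite (FE q xq).
  have := mpK xy yq (xq : leXp X (Some x) (Some q)) (v : top_ext M (Some x)).
  by rewrite y0 linear0.
have [f fE] : exists f : mor (itv K (x, y)) M,
    forall q w, f q w = itv_coef w *: F q.
  apply: mor_of_linear => [q a w w'|q s h w].
    by rewrite itv_coefP scalerDl scalerA.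
  rewrite lfunZ; have [sq|nq] := boolP (supp (x, y) (Some q)); last first.
    by rewrite (itv_eq0 w nq) linear0 /itv_coef !big1 ?scale0r // => i _; rewrite mxE.
  have [xq yq] := andP sq; have xs : leX X x s by exact: le_trans xq h.
  rewrite F_mp // [w in RHS]itv_span lfunZ itv_mp_one //.
  have -> : itv_coef (itv_coef w *: itv_one K (x, y) s) = itv_coef w * (supp (x, y) (Some s))%:R.
    by rewrite -itv_coef_one /itv_coef mulr_sumr; apply: eq_bigr => i _; rewrite mxE.
  have [ss|ns] := boolP (supp (x, y) (Some s)); first by rewrite mulr1.
  by rewrite F_dead ?scaler0.
have [g gE] : exists g : mor M (itv K (x, y)),
    forall q w, g q w = (G q w : K) *: itv_one K (x, y) q.
  apply: mor_of_linear => [q a w w'|q s h w].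
    by rewrite linearP scalerDl scalerA.
  have [ss|ns] := boolP (supp (x, y) (Some s)); last first.
    by rewrite [LHS]itv_eq0 // [RHS]itv_eq0.
  have [xs _] := andP ss; have sz' : leX X s z by exact: maxz.
  have qz : leX X q z by exact: le_trans h sz'.
  rewrite lfunZ (GE _ qz) (GE _ sz') (mpK _ _ qz).
  have [xq|qx] := leP (fsval x) (fsval q); first by rewrite itv_mp_one.
  suff -> : w = 0 by rewrite !linear0 !scale0r.
  apply: dim0_eq0; apply/eqP; rewrite -leqn0 leqNgt; apply/negP => /minx.
  by rewrite leNgt qx.
have gf q w : g q (f q w) = w.
  have [sq|nq] := boolP (supp (x, y) (Some q)); last by rewrite [LHS]itv_eq0 // [RHS]itv_eq0.
  have [xq0 _] := andP sq; have xq : leX X x q := xq0; have qz : leX X q z by exact: maxz.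
  rewrite gE fE lfunZ (GE _ qz) (FE _ xq) (mpK _ _ xz) lz /=.
  by rewrite [LHS](_ : _ = (itv_coef w * 1) *: itv_one K (x, y) q) // mulr1 -itv_span.
have [N [isoN dimN dimN']] := split_retract gf.
exists (x, y), N; split=> //.
(* The dimension drops at [x], where the interval is nonzero. *)
rewrite (bigD1 x) //= [ltnRHS](bigD1 x) //= -addSn leq_add ?leq_sum //.
apply: (dimN' x (itv_one K (x, y) x)).
apply: contraTneq (oner_neq0 K) => e; rewrite negbK.
rewrite -[1 in X in X == _]/(true%:R) -sx -itv_coef_one e.
by rewrite /itv_coef big1 // => i _; rewrite mxE.
Qed.

Lemma decomposition M : exists s : seq (bar X), all nonempty_bar s /\
  iso M (dsum (fun i : 'I_(size s) => itv K (nth (x0, None) s i))).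
Proof.
have [n] := ubnP (\sum_(q : X) dim (M q))%N; elim: n M => // n IHn M ltn.
have [[p [u u0]]|M0] := pselect (exists p, exists u : M p, u != 0); last first.
  exists [::]; split=> //; apply/is_zeroP => p u; apply/eqP.
  by apply: contrapT => u0; apply: M0; exists p, u; exact/negP.
have [c [N [cp isoN ltN]]] := split_interval u0.
have [s [sp isos]] := IHn N (leq_trans ltN ltn).
exists (c :: s); split; first by rewrite /= cp.
apply: iso_trans isoN _.
move: isos => /isoP[f [f' [ff' f'f]]].
have [k kE] : exists k : mor (sum_pfun (itv K c) N) (sum_pfun (itv K c) _),
    forall p u, k p u = (u.1, f p u.2).
  apply: mor_of_linear => [q a w w'|q s' h w].
    by congr pair; rewrite linearP.
  by rewrite !lfunE /= /sum_fun /= mor_mp.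
have [k' kE'] : exists k : mor (sum_pfun (itv K c) _) (sum_pfun (itv K c) N),
    forall p u, k p u = (u.1, f' p u.2).
  apply: mor_of_linear => [q a w w'|q s' h w].
    by congr pair; rewrite linearP.
  by rewrite !lfunE /= /sum_fun /= mor_mp.
apply/isoP; exists k, k'; split=> q w.
  by rewrite kE' kE ff'; case: w.
by rewrite kE kE' f'f; case: w.
Qed.

End Decomposition.

(** * Bars and interleavings *)

Section Bars.
Variables (R : realType) (K : fieldType) (b : R) (X : {fset R}).
Hypothesis b0 : 0 < b.
Variable x0 : X.
Local Notation pos := (pos b x0).
Local Notation lam := (lam b x0).
Local Notation le := (leXp X).
Local Notation bar := (bar X).
Implicit Types (c d : bar).

Definition birth c : R := pos (Some c.1).
Definition death c : R := pos c.2.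

Section Eps.
Variable e : R.
Hypothesis e0 : 0 <= e.

Definition close c d : bool :=
  (`|birth c - birth d| <= e) && (`|death c - death d| <= e).

Lemma closeC c d : close c d = close d c.
Proof. by rewrite /close distrC [in X in _ && X]distrC. Qed.

(** This is weaker than having length larger than [2e], as each of the shifts is
    rounded down to a point of [P_X^+]. *)
Definition long c : bool := ~~ le c.2 (lam e (lam e (Some c.1))).

Lemma close_mor c d : close c d ->
  exists phi : forall p, 'Hom(ext K c p, ext K d (lam e p)),
  (forall p u, phi p u = coeff u *: gen K d (lam e p)) /\
  (forall p q (h : le p q) (h' : le (lam e p) (lam e q)) u,
     mp (ext K d) h' (phi p u) = phi q (mp (ext K c) h u)).
Proof.
rewrite /close !ler_distl => /andP[/andP[b1 b2] /andP[d1 d2]].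
have /dep_choice[phi phiE] : forall p, exists
    k : 'Hom(ext K c p, ext K d (lam e p)),
    forall u, k u = coeff u *: gen K d (lam e p).
  by move=> p; apply: lfun_of_linear => a u v; rewrite coeffP scalerDl scalerA.
exists phi; split=> // p q h h' u; rewrite !phiE.
have [sp|np] := boolP (supp c p); last first.
  by rewrite (ext_eq0 u np) linear0 !coeff0 !scale0r linear0.
have /andP[cp pc] := sp.
have dp : le (Some d.1) (lam e p).
  by rewrite (le_lam b0) //; move: cp; rewrite (le_pos b0 x0) -/(birth c) -/(birth d); lra.
rewrite lfunZ mp_gen //.
have [cq|cq] := boolP (le c.2 q); last by rewrite coeff_mp.
rewrite gen_eq0 ?scaler0 // negb_and negbK; apply/orP; right.
by rewrite (le_lam b0) //; move: cq; rewrite (le_pos b0 x0) -/(death c) -/(death d); lra.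
Qed.

(** If the shifted image of [p] is already outside of [d], then it is past the
    death of [d], and a second shift takes it past the death of [c], where the
    structure map vanishes as well. *)
Lemma close_composite c d : close c d -> forall p (h : le p (lam e (lam e p))) u,
  coeff (coeff u *: gen K d (lam e p)) *: gen K c (lam e (lam e p)) =
  mp (ext K c) h u.
Proof.
rewrite /close !ler_distl => /andP[/andP[b1 b2] /andP[d1 d2]] p h u.
have [sp|np] := boolP (supp c p); last first.
  by rewrite (ext_eq0 u np) linear0 !coeff0 scale0r coeff0 scale0r.
have /andP[cp pc] := sp.
rewrite [u in RHS]gen_span lfunZ mp_gen // coeffZ coeff_gen -scalerA; congr (_ *: _).
have [sd|nd] := boolP (supp d (lam e p)); first by rewrite scale1r.
rewrite scale0r gen_eq0 //; rewrite /supp negb_and negbK; apply/orP; right.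
move: nd; rewrite /supp negb_and negbK => /orP[/negP[]|nd].
  by rewrite (le_lam b0) //; move: cp; rewrite (le_pos b0 x0) -/(birth c) -/(birth d); lra.
by rewrite (le_lam b0) //; move: nd; rewrite (le_pos b0 x0) -/(death c) -/(death d); lra.
Qed.

Lemma close_dI c d : close c d -> dI b (itv K c) (itv K d) <= e.
Proof.
move=> cd; have dc : close d c by rewrite closeC.
have [phi [phiE nphi]] := close_mor cd; have [psi [psiE npsi]] := close_mor dc.
apply/(dI_le b0 x0); split=> //; exists phi, psi; split=> // p h u.
  by rewrite psiE phiE close_composite.
by rewrite psiE phiE close_composite.
Qed.

Lemma short_width c : ~~ long c -> width b (itv K c) <= e.
Proof.
rewrite negbK => short; apply: (@width_lam_le R K b X b0 x0 (itv K c) e e0) => f p.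
apply/lfunP => u; rewrite [RHS]lfunE.
have [/andP[cp _]|np] := boolP (supp c p); last by rewrite (ext_eq0 u np) linear0.
apply: ext_eq0; rewrite /supp negb_and negbK; apply/orP; right => /=.
exact: leXp_trans short (lam_homo b0 x0 e0 (lam_homo b0 x0 e0 cp)).
Qed.

(** ** Matrix entries of an interleaving *)

Section Entries.
Variables (M N : pfun K le) (m n : nat) (S : 'I_m -> bar) (T : 'I_n -> bar).
Variables (injS : forall i, mor (ext K (S i)) M)
          (prjS : forall i, mor M (ext K (S i))).
Variables (injT : forall j, mor (ext K (T j)) N)
          (prjT : forall j, mor N (ext K (T j))).
Variable phi : forall p, 'Hom(M p, N (lam e p)).
Hypothesis phi_nat : forall p q (h : le p q) (h' : le (lam e p) (lam e q)) u,
  mp N h' (phi p u) = phi q (mp M h u).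

Definition entry (i : 'I_m) (j : 'I_n) : K :=
  coeff (prjT j (lam e (Some (S i).1))
    (phi _ (injS i _ (gen K (S i) (Some (S i).1))))).

(** The image of the generator of [S i] has to be killed no later than at the
    death of [S i], so the shifted [T j] dies no later; and it is nonzero only if
    the shifted [T j] is alive at the birth of [S i]. *)
Lemma entry_neq0 i j : nonempty_bar (S i) -> entry i j != 0 ->
  [/\ le (Some (T j).1) (lam e (Some (S i).1)),
      birth (T j) <= birth (S i) + e & death (T j) <= death (S i) + e].
Proof.
move=> pS; rewrite /entry; set p := Some _; set u := phi _ _ => ent.
have sT : supp (T j) (lam e p).
  by apply: contraNT ent => ns; rewrite (ext_eq0 (prjT j _ u) ns) coeff0.
have /andP[bT dT] := sT; split=> //.
  by rewrite /birth -(le_lam b0 x0 e0).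
rewrite /death -(le_lam b0 x0 e0); apply: contraNT ent => nd.
have pd : le p (S i).2.
  by move: pS; rewrite /nonempty_bar -/p !(le_pos b0 x0) -ltNge => /ltW.
have ld : le (lam e p) (lam e (S i).2) by exact: lam_homo.
have : coeff (mp (ext K (T j)) ld (prjT j _ u)) = coeff (prjT j _ u).
  exact: coeff_mp.
rewrite -mor_mp (phi_nat pd) -mor_mp mp_gen; last exact: (leXp_refl b0 x0).
rewrite gen_eq0; last by rewrite /supp (leXp_refl b0 x0) andbF.
by rewrite !linear0 coeff0 => <-.
Qed.
End Entries.

Section Composite.
Variables (M N : pfun K le) (m n : nat) (S : 'I_m -> bar) (T : 'I_n -> bar).
Variables (injS : forall i, mor (ext K (S i)) M)
          (prjS : forall i, mor M (ext K (S i))).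
Variables (injT : forall j, mor (ext K (T j)) N)
          (prjT : forall j, mor N (ext K (T j))).
Variables (phi : forall p, 'Hom(M p, N (lam e p))).
Variables (psi : forall p, 'Hom(N p, M (lam e p))).
Hypothesis phi_nat : forall p q (h : le p q) (h' : le (lam e p) (lam e q)) u,
  mp N h' (phi p u) = phi q (mp M h u).
Hypothesis psi_nat : forall p q (h : le p q) (h' : le (lam e p) (lam e q)) u,
  mp M h' (psi p u) = psi q (mp N h u).
Hypothesis psi_phi : forall p (h : le p (lam e (lam e p))) u,
  psi (lam e p) (phi p u) = mp M h u.
Hypothesis prj_inj : forall i p u, prjS i p (injS i p u) = u.
Hypothesis prj_inj0 : forall i k p u, i != k -> prjS k p (injS i p u) = 0.
Hypothesis sumT : forall p u, \sum_j injT j p (prjT j p u) = u.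
Hypothesis properS : forall i, nonempty_bar (S i).

Local Notation entry_phi := (entry injS prjT phi).
Local Notation entry_psi := (entry injT prjS psi).

(** The composite is a structure map, and it sends the generator at the birth of
    [S i] to the generator two shifts later. The coefficients there record the
    matrix entries, provided the bars are still alive. *)
Lemma entry_composite i k :
  ~~ le (S i).2 (lam e (lam e (Some (S i).1))) ->
  ~~ le (S k).2 (lam e (lam e (Some (S i).1))) ->
  \sum_j entry_psi j k * entry_phi i j = (i == k)%:R.
Proof.
set p := Some (S i).1 => li lk.
have pp : le p (lam e (lam e p)).
  by apply: leXp_trans (lam_ge b0 x0 e0 p) (lam_ge b0 x0 e0 _).
pose o := gen K (S i) p.
have -> : (i == k)%:R = coeff (prjS k _ (psi (lam e p) (phi p (injS i p o)))).
  rewrite (psi_phi pp) -mor_mp /o mp_gen; last exact: (leXp_refl b0 x0).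
  have [<-|ik] := eqVneq i k; last by rewrite prj_inj0 // coeff0.
  by rewrite prj_inj coeff_gen /supp pp li.
rewrite -{1}(sumT (phi p (injS i p o))) !lfun_sum coeff_sum; apply: eq_bigr => j _.
set u := prjT j _ _.
have -> : entry_phi i j = coeff u by [].
rewrite [u in RHS]gen_span !lfunZ coeffZ mulrC.
have [->|ent] := eqVneq (coeff u) 0; first by rewrite !mul0r.
congr (_ * _).
have sT : supp (T j) (lam e p).
  by apply: contraNT ent => ns; rewrite (ext_eq0 u ns) coeff0.
have /andP[bT _] := sT.
rewrite -(mp_gen K bT); last exact: (leXp_refl b0 x0).
have bT' : le (lam e (Some (T j).1)) (lam e (lam e p)) by exact: lam_homo.
by rewrite mor_mp -(psi_nat bT bT') mor_mp coeff_mp.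
Qed.

(** Order the bars by the sum of their endpoints. The later one of two long bars
    is still alive where two shifts take the birth of the earlier one, so that
    [entry_composite] applies; and a bar that contributes to this entry is close
    to one of the two, since otherwise they would be in the opposite order. *)
Lemma hall_condition (A : {set 'I_m}) : {in A, forall i, long (S i)} ->
  (forall j, nonempty_bar (T j)) ->
  (#|A| <= #|\bigcup_(i in A) [set j | close (S i) (T j)]%SET|)%N.
Proof.
move=> Al pT.
apply: (card_le_of_triangular (K := K) (phi := fun j i => entry_phi i j)
  (psi := fun k j => entry_psi j k) (w := fun i => birth (S i) + death (S i))).
- move=> i k iA kA /= ik; apply: entry_composite; first exact: Al.
  apply/negP => ki; move/negP: (Al k kA); apply; apply: (leXp_trans ki).
  do 2! apply: (lam_homo b0 x0 e0); rewrite (le_pos b0 x0) -/(birth _) -/(birth _).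
  have := Al i iA; rewrite /long => ni.
  have : ~~ le (S i).2 (S k).2 by apply: contra ni => ik2; exact: leXp_trans ik2 ki.
  by rewrite (le_pos b0 x0) -/(death _) -/(death _) -ltNge; move: ik; lra.
- move=> i k iA kA /= ik j; rewrite mulf_eq0 negb_or => /andP[ek ei].
  have [_ b1 d1] := entry_neq0 phi_nat (properS i) ei.
  have [_ b2 d2] := entry_neq0 psi_nat (pT j) ek.
  apply/finset.bigcupP; suff [ci|ck] : close (S i) (T j) \/ close (S k) (T j).
  + by exists i => //; rewrite inE.
  + by exists k => //; rewrite inE.
  apply/orP; apply: contraLR ik; rewrite negb_or /close !ler_distl !negb_and.
  rewrite -!ltNge => /andP[h1 h2].
  by move: h1 h2 => /orP[] /orP[] ? /orP[] /orP[] ?; lra.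
Qed.
End Composite.
End Eps.
End Bars.

(** * The isometry theorem *)

Section Isometry.
Variables (R : realType) (K : fieldType) (b : R) (X : {fset R}).
Hypothesis b0 : 0 < b.
Variable x0 : X.
Implicit Types M N : pmod K X.
Local Notation lam := (lam b x0).

(** Matched summands are interleaved, unmatched ones have zero structure maps
    across two shifts, and an interleaving of the sums is assembled from these. *)
Lemma eps_matching_thin_interleaved M N (e : R) m n (S : 'I_m -> pmod K X)
    (T : 'I_n -> pmod K X) (f : 'I_m -> option 'I_n) :
  0 <= e -> is_barcode M S -> is_barcode N T -> is_eps_matching b e S T f ->
  thin_interleaved (lam e) (lam e) (top_ext M) (top_ext N).
Proof.
move=> e0 [_ isoM] [_ isoN] [f_inj wS wT close].
have bM := biproduct_top_ext (biproduct_iso isoM (biproduct_dsum S)).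
have bN := biproduct_top_ext (biproduct_iso isoN (biproduct_dsum T)).
apply: (thin_interleaved_matched (f := f) bM bN) => //; try exact: (lam_homo b0).
- by move=> i j /close /(dI_le b0 x0)[].
- move=> i fi; have /(width_le b0 x0)[] // : width b (S i) <= e.
  by rewrite leNgt; apply/negP => /wS[j]; rewrite fi.
- move=> j nj; have /(width_le b0 x0)[] // : width b (T j) <= e.
  by rewrite leNgt; apply/negP => /wT[i]; exact: nj.
Qed.

Lemma dI_le_eps_matching M N (e : R) : dI b M N <= e -> exists m n (S : 'I_m -> pmod K X)
    (T : 'I_n -> pmod K X), [/\ is_barcode M S, is_barcode N T &
    exists f, forall e', e <= e' -> is_eps_matching b e' S T f].
Proof.
move=> /(dI_le b0 x0)[e0 [phi [psi [n1 n2 c1 c2]]]].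
have [s [/allP sP isoM]] := decomposition b0 x0 M.
have [t [/allP tP isoN]] := decomposition b0 x0 N.
pose S (i : 'I_(size s)) := nth (x0, None) s i.
pose T (j : 'I_(size t)) := nth (x0, None) t j.
have pS i : nonempty_bar (S i) by apply: sP; exact: mem_nth.
have pT j : nonempty_bar (T j) by apply: tP; exact: mem_nth.
exists (size s), (size t), (fun i => itv K (S i)), (fun j => itv K (T j)); split.
- by split=> // i; exact: itv_indecomposable.
- by split=> // j; exact: itv_indecomposable.
have [iS [qS [S1 S0 Ssum]]] := biproduct_top_ext (biproduct_iso isoM (biproduct_dsum _)).
have [iT [qT [T1 T0 Tsum]]] := biproduct_top_ext (biproduct_iso isoN (biproduct_dsum _)).
pose cl i j := close b x0 e (S i) (T j).
have hallS (A : {set 'I_(size s)}) : A \subset [set i | long b x0 e (S i)]%SET ->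
    (#|A| <= #|\bigcup_(i in A) [set j | cl i j]%SET|)%N.
  move=> /fintype.subsetP AL.
  by apply: (hall_condition b0 e0 n1 n2 c1 S1 S0 Tsum pS _ pT) => i /AL; rewrite inE.
have hallT (A : {set 'I_(size t)}) : A \subset [set j | long b x0 e (T j)]%SET ->
    (#|A| <= #|\bigcup_(j in A) [set i | close b x0 e (T j) (S i)]%SET|)%N.
  move=> /fintype.subsetP AL.
  by apply: (hall_condition b0 e0 n2 n1 c2 T1 T0 Ssum pT _ pS) => i /AL; rewrite inE.
have [f [fE f_inj]] := hall_marriage hallS; have [g [gE g_inj]] := hall_marriage hallT.
have [||||h [h_inj hS hT hcl]] := @mendelsohn_dulmage _ _ (fun i j => cl i j)
  [set i | long b x0 e (S i)]%SET [set j | long b x0 e (T j)]%SET f g.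
- by move=> i /fE[j fi]; rewrite inE => c; exists j.
- exact: f_inj.
- by move=> j /gE[i gj]; rewrite inE closeC => c; exists i.
- exact: g_inj.
(* A single matching serves all larger bounds, which is needed for the bound 0,
   as the bottleneck distance only takes matchings with a positive bound. *)
exists h => e' ee'; split=> //.
- move=> i wi; apply: hS; rewrite inE; apply: contraLR wi => /(short_width K b0 e0).
  by rewrite -leNgt => /le_trans; exact.
- move=> j wj; apply: hT; rewrite inE; apply: contraLR wj => /(short_width K b0 e0).
  by rewrite -leNgt => /le_trans; exact.
- by move=> i j /hcl c; apply: le_trans ee'; exact: (close_dI K b0 e0 c).
Qed.

Theorem dI_eq_dB M N : dI b M N = dB b M N.
Proof.
have [m [n [S [T [bS bT [f fe]]]]]] := dI_le_eps_matching (lexx (dI b M N)).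
have dI0 := dI_ge0 b0 x0 M N.
apply/le_anti/andP; split.
  apply: lb_le_inf; first (exists (dI b M N + 1); split; first lra).
    by exists m, n, S, T; split=> //; exists f; apply: fe; lra.
  move=> e [e0 [m' [n' [S' [T' [bS' bT' [f' fe']]]]]]].
  apply/(dI_le b0 x0); split; first exact: ltW.
  exact: eps_matching_thin_interleaved (ltW e0) bS' bT' fe'.
apply/ler_addgt0Pr => d d0; apply: ge_inf; first by exists 0 => e [/ltW].
split; first lra.
by exists m, n, S, T; split=> //; exists f; apply: fe; lra.
Qed.

End Isometry.

(** * Extension along an inclusion of finite sets *)

Section Extension.
Variables (R : realType) (K : fieldType) (b : R) (X Y : {fset R}).
Hypothesis b0 : 0 < b.
Variables (x0 : X) (y0 : Y).
Hypothesis XY : {subset X <= Y}.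
Hypothesis YX : forall y : R, y \in Y -> exists2 x, x \in X & y <= x.
Implicit Types M N : pmod K X.

(** With a least element added to [P_X^+], rounding down to [X] becomes a total
    map from [P_Y^+], and [jmod] a restriction along it. *)
Local Notation le2 := (bot_rel (top_rel (leX X))).

Definition floor2 (p : option Y) : option (option X) :=
  match p with Some y => omap Some (Defs.floorX X (fsval y)) | None => Some None end.

Lemma floor2_homo p q : leXp Y p q -> le2 (floor2 p) (floor2 q).
Proof.
case: p q => [y|] [z|] //= yz; last by case: (Defs.floorX X _).
move: (floorX_homo X yz); case: (Defs.floorX X (fsval y)) => [?|];
  by case: (Defs.floorX X (fsval z)) => [?|].
Qed.

Lemma le2_trans : transitive le2.
Proof. by move=> [q|] [p|] [s|] //=; exact: leXp_trans. Qed.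

Lemma pos_top : pos b x0 None = pos b y0 None.
Proof.
congr (_ + _); apply/le_anti/andP; split; apply: bigmax_le => [|z _].
- exact: (ge_maxX y0 [` XY (fsvalP x0)]%fset).
- exact: (ge_maxX y0 [` XY (fsvalP z)]%fset).
- have [x xX y0x] := YX (fsvalP y0).
  exact: le_trans y0x (ge_maxX x0 [` xX]%fset).
- have [x xX zx] := YX (fsvalP z).
  exact: le_trans zx (ge_maxX x0 [` xX]%fset).
Qed.

(** A point of [X] within [e] of [p] is also a point of [Y], so the shift on [Y]
    passes it before it is rounded down to [X]. *)
Lemma lam_floor2 (e : R) : 0 <= e -> forall p,
  le2 (omap (lam b x0 e) (floor2 p)) (floor2 (lam b y0 e p)).
Proof.
move=> e0 p; case fp: (floor2 p) => [q|//].
have qp : pos b x0 q <= pos b y0 p.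
  case: p fp => [y|[<-]]; last by rewrite pos_top.
  rewrite /=; have := floorXP X (fsval y).
  by case: (Defs.floorX X _) => //= x [xy _] [<-].
case ls: (lam b x0 e q) => [x|] /=; rewrite ?ls.
  have : leXp Y (Some [` XY (fsvalP x)]%fset) (lam b y0 e p).
    rewrite (le_lam b0) //=; have := pos_lam b0 x0 e0 q; rewrite ls /=; lra.
  case: (lam b y0 e p) => [y|//]; rewrite /= => xy.
  have := floorXP X (fsval y); case: (Defs.floorX X _) => [x' [_ mx]|nx] /=.
    exact: mx.
  by case/negP: (nx x); exact: xy.
have : leXp Y None (lam b y0 e p).
  by rewrite (le_lam b0) // -pos_top; have := pos_lam b0 x0 e0 q; rewrite ls; lra.
by case: (lam b y0 e p).
Qed.

Lemma thin_interleaved_bot_ext (T : Type) (r : rel T) (L G : T -> T) (M N : pfun K r) :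
  thin_interleaved L G M N -> thin_interleaved (omap L) (omap G) (bot_ext M) (bot_ext N).
Proof.
have V0 (u v : 'rV[K]_0) : u = v by rewrite [u]thinmx0 [v]thinmx0.
move=> [phi [psi [n1 n2 c1 c2]]].
pose phi' (p : option T) : 'Hom(bot_ext M p, bot_ext N (omap L p)) :=
  match p with Some p' => phi p' | None => 0 end.
pose psi' (p : option T) : 'Hom(bot_ext N p, bot_ext M (omap G p)) :=
  match p with Some p' => psi p' | None => 0 end.
exists phi', psi'; split=> [[p|] [q|] h h' u|[p|] [q|] h h' u|[p|] h u|[p|] h u];
  by [|exact: n1|exact: n2|exact: c1|exact: c2|exact: V0|rewrite /= !lfunE /= linear0].
Qed.

(** The two sides have the same spaces, but their definitions only reduce to the
    same form once it is known whether there is a point of [X] below. *)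
Lemma top_ext_jmod M :
  iso (pullback floor2_homo (bot_ext (top_ext M))) (top_ext (jmod Y M)).
Proof.
have V0 (u v : 'rV[K]_0) : u = v by rewrite [u]thinmx0 [v]thinmx0.
pose k (z : option X) : 'Hom(opt_ob (top_ext M) (omap Some z), opt_ob M z) :=
  match z with Some x => \1%VF | None => \1%VF end.
pose k' (z : option X) : 'Hom(opt_ob M z, opt_ob (top_ext M) (omap Some z)) :=
  match z with Some x => \1%VF | None => \1%VF end.
have kk z u : k' z (k z u) = u by case: z u => [z|] u; rewrite /= !id_lfunE.
have k'k z u : k z (k' z u) = u by case: z u => [z|] u; rewrite /= !id_lfunE.
have kn z z' (h : bot_rel (leX X) z z')
    (h' : le2 (omap Some z) (omap Some z')) u :
    mp (bot_ext M) h (k z u) = k z' (mp (bot_ext (top_ext M)) h' u).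
  case: z z' h h' u => [z|] [z'|] //= h h' u; rewrite ?lfunE /= ?lfunE //=.
  by rewrite (mp_irr M h h').
pose f (p : option Y) : 'Hom(pullback floor2_homo (bot_ext (top_ext M)) p, top_ext (jmod Y M) p) :=
  match p with Some y => k (Defs.floorX X (fsval y)) | None => \1%VF end.
pose f' (p : option Y) : 'Hom(top_ext (jmod Y M) p, pullback floor2_homo (bot_ext (top_ext M)) p) :=
  match p with Some y => k' (Defs.floorX X (fsval y)) | None => \1%VF end.
have ff p u : f' p (f p u) = u by case: p u => [y|] u; [exact: kk|exact: V0].
have f'f p u : f p (f' p u) = u by case: p u => [y|] u; [exact: k'k|exact: V0].
have fn p q (h : leXp Y p q) u : mp (top_ext (jmod Y M)) h (f p u) =
    f q (mp (pullback floor2_homo (bot_ext (top_ext M))) h u).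
  case: p q h u => [y|] [z|] // h u; try exact: V0.
  exact: (kn _ _ (floorX_homo X h) (floor2_homo h) u).
have [g gE] := mor_of_linear (fun p => linearP (f p)) fn.
have f'n p q (h : leXp Y p q) u : mp (pullback floor2_homo (bot_ext (top_ext M))) h (f' p u) =
    f' q (mp (top_ext (jmod Y M)) h u).
  by rewrite -{2}(f'f p u) fn ff.
have [g' gE'] := mor_of_linear (fun p => linearP (f' p)) f'n.
by apply/isoP; exists g, g'; split=> p u; rewrite gE gE'; [exact: ff|exact: f'f].
Qed.

Theorem jmod_contraction M N : dI b (jmod Y M) (jmod Y N) <= dI b M N.
Proof.
have [e0 il] := (dI_le b0 x0 M N (dI b M N)).1 (lexx _).
apply/(dI_le b0 y0); split=> //.
apply: (thin_interleaved_iso (top_ext_jmod M) (top_ext_jmod N)).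
pose L := omap (lam b x0 (dI b M N)).
apply: (@thin_interleaved_pullback _ _ _ _ _ _ floor2_homo L L) => //.
- exact: le2_trans.
- by move=> [p|] [q|] //; exact: lam_homo.
- by move=> [p|] [q|] //; exact: lam_homo.
- by move=> [p|] //; exact: lam_ge.
- by move=> [p|] //; exact: lam_ge.
- by move=> p q; exact: lam_homo.
- by move=> p q; exact: lam_homo.
- exact: lam_floor2.
- exact: lam_floor2.
- exact: thin_interleaved_bot_ext.
Qed.

End Extension.

Section Refinement.
Variable R : realType.
Implicit Types X Y Z N : {fset R}.

(** The invariant of the refinement steps: as they subtract nonnegative numbers
    from existing points, they keep the maximum. *)
Definition extends_below Z Y : Prop :=
  {subset Z <= Y} /\ forall y, y \in Y -> exists2 z, z \in Z & y <= z.

Lemma extends_below_trans X Y Z :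
  extends_below X Y -> extends_below Y Z -> extends_below X Z.
Proof.
move=> [XY YX] [YZ ZY]; split=> [x /XY/YZ //|z /ZY[y /YX[x xX yx] zy]].
by exists x => //; exact: le_trans zy yx.
Qed.

Lemma distances_ge0 X e : e \in distances X -> 0 <= e.
Proof. by case/imfset2P => x xX [y yX ->]; exact: normr_ge0. Qed.

Lemma extends_below_pre X : extends_below X (pre_refinement X).
Proof.
split=> [x xX|y]; first by rewrite /pre_refinement inE xX.
rewrite /pre_refinement inE => /orP[yX|]; first by exists y.
case/imfset2P => x xX [e /distances_ge0 e0 ->]; exists x => //.
by rewrite gerBl.
Qed.

Lemma extends_below_step N Z y : {in N, forall e, 0 <= e} ->
  extends_below Z (refine_step N Z y).
Proof.
move=> N0; rewrite /refine_step; case: pickP => [z _|_]; last first.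
  by split=> // z zZ; exists z.
split=> [x xZ|x]; first by rewrite inE xZ.
rewrite inE => /orP[xZ|]; first by exists x.
case/imfsetP => e /N0 e0 ->; exists (fsval z); first exact: fsvalP.
by rewrite gerBl.
Qed.

Lemma extends_below_Sh X : extends_below X (Sh X).
Proof.
suff steps s : forall Z, extends_below Z (foldl (refine_step (distances X)) Z s).
  exact: extends_below_trans (extends_below_pre X) (steps _ _).
elim: s => [|y s IHs] Z /=; first by split=> // z zZ; exists z.
by apply: extends_below_trans (IHs _); apply: extends_below_step => e; exact: distances_ge0.
Qed.

End Refinement.

Theorem theorem1 (R : realType) (K : fieldType) (b : R) (hb : 0 < b)
    (X1 : {fset R}) (hX1 : X1 != fset0) :
  [/\ forall I M : pmod K (Sh X1), im_j X1 I -> im_j X1 M ->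
        dI b I M = dB b I M,
      forall I M : pmod K X1,
        dI b (jmod (Sh X1) I) (jmod (Sh X1) M) <= dI b I M &
      forall I M : pmod K X1,
        dB b (jmod (Sh X1) I) (jmod (Sh X1) M) <= dI b I M].
Proof.
have [x xX] := fset0Pn _ hX1.
have [XSh ShX] := extends_below_Sh X1.
pose x0 : X1 := [` xX]%fset; pose y0 : Sh X1 := [` XSh _ xX]%fset.
have contract := jmod_contraction (K := K) hb x0 y0 XSh ShX.
split=> [I M _ _|//|I M]; first exact: (dI_eq_dB hb y0).
by rewrite -(dI_eq_dB hb y0).
Qed.
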